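(* Consider the adaptive shortest-path routing problem described in the context, with path-set dimension $d$, and suppose that the edge costs have finite moments up to order $q$ for some $q>1$, i.e. $\mathbb{E}[|W_e(t)|^q]<\infty$ for every edge $e$. Choose a constant $v>0$. Construct the exploration sequence by $\mathcal{A}(1)=\{1\}$ and, for each $t>1$: $\mathcal{A}(t)=\mathcal{A}(t-1)\cup\{t\}$ if $|\mathcal{A}(t-1)|<v\,t^{1/q}$, and $\mathcal{A}(t)=\mathcal{A}(t-1)$ otherwise. Let $\pi^q$ be the Adaptive Shortest-Path Routing Algorithm (defined in the context) run with this exploration sequence. Then there is a constant $D$, independent of $d$ and $T$ (it may depend on $v$, $q$ and the edge cost distributions), such that $$R^{\pi^q}(T)\le D\,d\,T^{1/q}.$$
   Context: Problem. $G=(V,E)$ is a finite directed graph consisting of all simple paths from a source $s$ to a destination $r$; $m=|E|$, and $\mathcal{P}$ is the (finite) set of all paths from $s$ to $r$ in $G$. At each time $t=1,2,\dots$ each edge $e\in E$ is assigned a random cost $W_e(t)$ with unknown distribution; the cost vectors $(W_e(t))_{e\in E}$ are i.i.d. over $t$. At each time $t$ a policy $\pi$ chooses, based on past observations, a path $p\in\mathcal{P}$, and then only the total cost $C_t(p)=\sum_{e\in p}W_e(t)$ is observed (individual edge costs are not). $C_t(\pi)$ denotes the total cost of the path chosen by $\pi$ at time $t$. Let $\sigma(1)$ be a path of minimum expected cost. The regret is $R^{\pi}(T)=\mathbb{E}\big[\sum_{t=1}^T (C_t(\pi)-C_t(\sigma(1)))\big]$. Path vectors and barycentric spanner. Each path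 $p$ is identified with its $0/1$ incidence vector $\vec p\in\mathbb{R}^m$ (entry $1$ iff the edge is on the path); $d\le m$ is the dimension of the linear span of all path vectors. A barycentric spanner of the path set is a set $B=\{\vec p_1,\dots,\vec p_d\}$ of $d$ path vectors such that every path vector is a linear combination of elements of $B$ with coefficients in $[-1,1]$. Such a $B$ exists and is fixed; its paths are denoted $p_1,\dots,p_d$. Algorithm. $\mathcal{A}(t)\subseteq\{1,\dots,t\}$ is the set of exploration times up to and including $t$, with $|\mathcal{A}(t)|$ its cardinality. For positive integers $k,l$ let $k\oslash l=((k-1)\bmod l)+1$. Let $\overline\theta_{p_i}(t)$ ($i=1,\dots,d$) be the sample mean of the past cost observations on path $p_i$ (an arbitrary fixed value, e.g. $0$, if there are none yet). At time $t$: if $t\in\mathcal{A}(t)$, choose path $p_n$ with $n=|\mathcal{A}(t)|\oslash d$. If $t\notin\mathcal{A}(t)$, then for every $p\in\mathcal{P}$ write $\vec p=\sum_{i=1}^d a_i\vec p_i$ with $|a_i|\le1$, set $\overline\theta_p(t)=\sum_{i=1}^d a_i\overline\theta_{p_i}(t)$, and choose a path minimizing $\overline\theta_p(t)$ over $p\in\mathcal{P}$. *)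

(* Defs.v *)
(* MathComp / MathComp-Analysis. *)
From HB Require Import structures.
From mathcomp Require Import all_boot all_order all_algebra.
From mathcomp Require Import finmap.
From mathcomp Require Import all_classical all_reals all_analysis.

Set Implicit Arguments.
Unset Strict Implicit.
Unset Printing Implicit Defensive.

Import Order.TTheory GRing.Theory Num.Theory.
Import numFieldNormedType.Exports.

Local Open Scope classical_set_scope.
Local Open Scope ring_scope.

(* Edges are the elements of 'I_m, with end points given by [src] and [dst].
   A path is its sequence of edges.  A simple path repeats no edge, so bounding
   the length by m loses nothing and makes the type of paths finite. *)
Notation epath m := (m.-bseq 'I_m).

Section Graph.
Variables (m : nat) (V : finType) (src dst : 'I_m -> V) (s r : V).

Definition vertices_of (p : epath m) : seq V := s :: [seq dst e | e <- p].

(* The tails of the edges are the visited vertices except the last one. *)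
Definition simple_path (p : epath m) : bool :=
  [&& [seq src e | e <- p] == belast s [seq dst e | e <- p],
      last s [seq dst e | e <- p] == r & uniq (vertices_of p)].

Definition paths : {set epath m} := [set p | simple_path p]%SET.

(* A digraph without parallel edges, each edge and vertex of which lies on a
   simple path from s to r. *)
Definition simple_path_digraph : Prop :=
  [/\ injective (fun e => (src e, dst e)),
      forall e : 'I_m, exists2 p, p \in paths & e \in p
    & forall x : V, exists2 p, p \in paths & x \in vertices_of p].

Section Vectors.
Variable R : realType.

Definition path_vector (p : epath m) : 'rV[R]_m := \row_(e < m) (e \in p)%:R.

Definition path_dim : nat :=
  \dim (span [seq path_vector p | p <- enum paths]).

(* [a p] decomposes [p] over the paths in B, with coefficients in [-1, 1]. *)
Definition spanner_coefficients (d : nat) (B : 'I_d -> epath m)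
    (a : epath m -> 'I_d -> R) : Prop :=
  forall p, p \in paths ->
    (forall i, `|a p i| <= 1) /\
    path_vector p = \sum_(i < d) a p i *: path_vector (B i).

Definition barycentric_spanner (d : nat) (B : 'I_d -> epath m) : Prop :=
  [/\ d = path_dim,
      forall i, B i \in paths,
      injective (fun i => path_vector (B i))
    & exists a, spanner_coefficients B a].

End Vectors.
End Graph.

Section Costs.
Context {dsp : measure_display} {Omega : measurableType dsp} {R : realType}.
Variables (P : probability Omega R) (m : nat).
Variable W : nat -> 'I_m -> {RV P >-> R}. (* only times t >= 1 are relevant *)

(* The product sigma-algebra of R^m. *)
Definition borel_vec : set (set ('I_m -> R)) :=
  <<s [set [set x : 'I_m -> R | A (x e)] | e in [set: 'I_m] & A in measurable] >>.

Definition cost_vector (t : nat) (w : Omega) : 'I_m -> R := fun e => W t e w.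

Definition iid_costs : Prop :=
  (forall t A, (0 < t)%N -> borel_vec A ->
     P (cost_vector t @^-1` A) = P (cost_vector 1 @^-1` A)) /\
  (forall (J : {fset nat}) (A : nat -> set ('I_m -> R)),
     (0%N \notin J) -> (forall t, borel_vec (A t)) ->
     P (\bigcap_(t in [set` J]) (cost_vector t @^-1` A t)) =
     (\prod_(t <- J) P (cost_vector t @^-1` A t))%E).

(* Equality is required on Borel sets only: the value of a measure on a
   non-measurable set is meaningless. *)
Definition marginals (mu : 'I_m -> probability R R) : Prop :=
  forall t e A, (0 < t)%N -> measurable A ->
    distribution P (W t e) A = mu e A.

Definition path_cost (t : nat) (p : epath m) (w : Omega) : R :=
  \sum_(e <- p) W t e w.

Definition min_expected_cost (Q : {set epath m}) (sigma1 : epath m) : Prop :=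
  sigma1 \in Q /\
  forall p, p \in Q -> ('E_P[path_cost 1 sigma1] <= 'E_P[path_cost 1 p])%E.

(* X t w is the path chosen at time t, and path_cost t (X t w) w the only cost
   observed then. *)
Variable X : nat -> Omega -> epath m.

Definition past_observations (t : nat) : set (set Omega) :=
  <<s [set F : set Omega | exists j p (U : set R),
        [/\ (0 < j < t)%N, measurable U
          & F = [set w | X j w = p /\ U (path_cost j p w)]]] >>.

Definition policy : Prop :=
  forall t p, (0 < t)%N -> past_observations t [set w | X t w = p].

Definition regret (sigma1 : epath m) (T : nat) : \bar R :=
  'E_P[fun w => \sum_(1 <= t < T.+1)
         (path_cost t (X t w) w - path_cost t sigma1 w)].

(* theta0 is the arbitrary default when p has not been chosen yet. *)
Definition sample_mean (theta0 : R) (p : epath m) (t : nat) (w : Omega) : R :=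
  let n := (\sum_(1 <= j < t | X j w == p) 1)%N in
  if n == 0%N then theta0
  else (\sum_(1 <= j < t | X j w == p) path_cost j p w) / n%:R.

End Costs.

Definition oslash (k l : nat) : nat := (k.-1 %% l).+1.

(* exploration v q t is A(t), the set of exploration times up to t. *)
Fixpoint exploration {R : realType} (v q : R) (t : nat) : {fset nat} :=
  match t with
  | 0 => fset0
  | 1 => [fset 1%N]%fset
  | t'.+1 =>
      let A := exploration v q t' in
      if (#|` A|%:R < v * t%:R `^ q^-1) then (t |` A)%fset else A
  end.

Section Algorithm.
Context {dsp : measure_display} {Omega : measurableType dsp} {R : realType}.
Variables (P : probability Omega R) (m : nat) (W : nat -> 'I_m -> {RV P >-> R}).
Variables (Q : {set epath m}) (A : nat -> {fset nat}).
Variables (d : nat) (B : 'I_d -> epath m) (a : epath m -> 'I_d -> R).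
Variables (theta0 : R) (X : nat -> Omega -> epath m).

Definition path_estimate (p : epath m) (t : nat) (w : Omega) : R :=
  \sum_(i < d) a p i * sample_mean W X theta0 (B i) t w.

(* The basis path p_n is [B i] with n = i.+1.  Ties in the minimization are
   broken arbitrarily. *)
Definition adaptive_shortest_path_routing : Prop :=
  forall t w, (0 < t)%N ->
    X t w \in Q /\
    if t \in A t
    then forall i : 'I_d, i.+1 = oslash #|` A t| d -> X t w = B i
    else forall p, p \in Q ->
           path_estimate (X t w) t w <= path_estimate p t w.

End Algorithm.

(* Main.v *)
(* Only exploitation rounds need work, since there are O(T^(1/q)) exploration
   rounds.  A suboptimal path p is exploited at time t only if some basis path
   p_i has a sample mean off by at least 2 eps.  Give the empirical sum of p_i an
   extra drift - eps per observation: the resulting walk Y then exceeds eps times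
   the number of observations, hence a barrier x of order t^(1/q), because the
   exploration rounds alone observe p_i about v t^(1/q) / d times.  With only
   q > 1 moments, the function u |-> min(1, (r / u)^(q - 1)) of the distance u to
   the barrier is a supermartingale along any walk with negative drift (the
   one-sided bound of Kiefer and Wolfowitz), and this survives the adaptive choice
   of the observation times.  So the error probability is of order
   (t^(1/q))^(1 - q) = t^(1/q - 1), which sums to O(T^(1/q)).  All constants depend
   on the marginals only, through finitely many paths. *)
Require Import Defs.
From HB Require Import structures.
From mathcomp Require Import all_boot all_order all_algebra.
From mathcomp Require Import finmap.
From mathcomp Require Import all_classical all_reals all_analysis measurable_realfun.
From mathcomp Require Import ring lra.
Import Order.TTheory GRing.Theory Num.Theory.
Import numFieldNormedType.Exports.
Local Open Scope classical_set_scope.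
Local Open Scope ring_scope.

Set Implicit Arguments.
Unset Strict Implicit.
Unset Printing Implicit Defensive.

(** * Power inequalities and the one-step estimate for the crossing bound *)

Section RealInequalities.
Context {R : realType}.
Implicit Types a b e r x y z u h q M : R.

Lemma powR_le1 x a : 0 <= a -> 0 <= x -> x <= 1 -> x `^ a <= 1.
Proof.
move=> a0 x0 x1; have e1 : 1 `^ a = 1 :> R by rewrite powR1.
by rewrite -[leRHS]e1 ge0_ler_powR ?nnegrE.
Qed.

Lemma powR_ge1 x a : 0 <= a -> 1 <= x -> 1 <= x `^ a.
Proof. by move=> a0 x1; rewrite -[leLHS](powRr0 x) ler_powR. Qed.

Lemma powR_div x y a : 0 <= x -> 0 <= y -> (x / y) `^ a = x `^ a / y `^ a.
Proof.
move=> x0 y0; rewrite powRM ?invr_ge0//; congr (_ * _).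
by rewrite -[y^-1]powR_inv1// -powRrM mulN1r powRN.
Qed.

(** Put [y = a * z / (1 - z)]. Since [ln (1 + x) <= x] at [x = z / (1 - z)], the left side is at
    most [expR y], which is at most [(1 - y)^-1]. The latter is exactly the right side. *)
Lemma powR_inv1B_le a z : 0 < a -> (1 + a) * z < 1 ->
  ((1 - z)^-1) `^ a <= 1 + a * z / (1 - (1 + a) * z).
Proof.
move=> a0 z1.
have dz : 0 < 1 - (1 + a) * z by lra.
have z0 : 0 < 1 - z.
  have [zn|zp] := leP z 0; first by lra.
  by have := mulr_gt0 a0 zp; lra.
have i0 : 0 < (1 - z)^-1 by rewrite invr_gt0.
pose y := a * (z / (1 - z)).
have y1 : 1 - y = (1 - (1 + a) * z) / (1 - z) by rewrite /y; field; lra.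
have y10 : 0 < 1 - y by rewrite y1 divr_gt0.
apply: (@le_trans _ _ (expR y)).
  rewrite /powR gt_eqF// ler_expR /y ler_wpM2l ?(ltW a0)//.
  have e1 : (1 - z)^-1 = 1 + z / (1 - z) by field; lra.
  rewrite {1}e1; apply: le_ln1Dx.
  have -> : z / (1 - z) = (1 - z)^-1 - 1 by field; lra.
  by lra.
have -> : 1 + a * z / (1 - (1 + a) * z) = (1 - y)^-1.
  by rewrite y1; field; apply/andP; split; lra.
rewrite -[expR y]invrK -expRN lef_pV2 ?posrE ?expR_gt0//.
exact: expR_ge1Dx.
Qed.

(** For [|z| <= 1] the previous bound leaves a quadratic remainder whose denominator is at least
    [1 / 2], and [z ^+ 2] is at most the power [1 + b] of [|z|]. Otherwise [z < -1]: the left side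
    is at most [1], and the error term outweighs [a * |z|]. *)
Lemma powR_inv1B_le_quad a b z : 0 < a -> 0 < b <= 1 -> 2 * (1 + a) * z <= 1 ->
  ((1 - z)^-1) `^ a <= 1 + a * z + 2 * a * (1 + a) * `|z| `^ (1 + b).
Proof.
move=> a0 /andP[b0 b1] z1.
have dz : 1 / 2 <= 1 - (1 + a) * z by lra.
have K0 : 0 < 2 * a * (1 + a) by rewrite !mulr_gt0//; lra.
have [zle1|zgt1] := leP `|z| 1.
  have zz : z ^+ 2 <= `|z| `^ (1 + b).
    have [->|zn0] := eqVneq z 0; first by rewrite expr0n/= powR_ge0.
    rewrite -real_normK ?num_real// -powR_mulrn//.
    by apply: ger_powR; rewrite ?normr_gt0 ?zn0 ?zle1//; lra.
  apply: (le_trans (@powR_inv1B_le a z _ _)) => //; first by lra.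
  have -> : a * z / (1 - (1 + a) * z) =
            a * z + a * (1 + a) * z ^+ 2 / (1 - (1 + a) * z).
    by field; lra.
  rewrite addrA lerD2l.
  apply: (@le_trans _ _ (2 * a * (1 + a) * z ^+ 2)); last by rewrite ler_wpM2l// ltW.
  rewrite ler_pdivrMr; last by lra.
  have : 0 <= a * (1 + a) * z ^+ 2.
    by apply: mulr_ge0 (sqr_ge0 z); apply: mulr_ge0; lra.
  by nra.
have zneg : z < -1.
  have [zn|zp] := ltP z 0; first by move: zgt1; rewrite ltr0_norm//; lra.
  move: zgt1; rewrite ger0_norm// => zgt1.
  by have := mulr_ge0 (ltW a0) zp; lra.
have zabs : `|z| = - z by rewrite ltr0_norm//; lra.
have h1 : `|z| <= `|z| `^ (1 + b) by apply: le1r_powR; [exact: ltW|lra].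
apply: (@le_trans _ _ 1).
  have i0 : (1 - z)^-1 <= 1 by rewrite invf_le1; lra.
  by apply: powR_le1; rewrite ?invr_ge0//; lra.
have h2 : a * `|z| <= 2 * a * (1 + a) * `|z| `^ (1 + b).
  apply: ler_pM => //; [exact: ltW|by nra].
by rewrite zabs in h1 h2 *; lra.
Qed.

(* Bounds the probability that a random walk with negative drift, currently at
   distance [x] below a barrier, ever crosses that barrier. *)
Definition crossing_bound a r x : R := (r / Num.max x r) `^ a.

Lemma crossing_bound_ge0 a r x : 0 <= crossing_bound a r x.
Proof. exact: powR_ge0. Qed.

Lemma crossing_bound_le1 a r x : 0 < a -> 0 < r -> crossing_bound a r x <= 1.
Proof.
move=> a0 r0; rewrite /crossing_bound.
have m0 : 0 < Num.max x r by rewrite lt_max r0 orbT.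
rewrite powR_le1 ?divr_ge0 ?(ltW a0) ?(ltW r0) ?(ltW m0)//.
by rewrite ler_pdivrMr// mul1r le_max lexx orbT.
Qed.

Lemma crossing_bound1 a r x : 0 < r -> x <= r -> crossing_bound a r x = 1.
Proof.
by move=> r0 xr; rewrite /crossing_bound max_r// divff ?gt_eqF// powR1.
Qed.

Lemma crossing_bound_le a r x y : 0 < a -> 0 < r -> 0 < y -> y <= Num.max x r ->
  crossing_bound a r x <= (r / y) `^ a.
Proof.
move=> a0 r0 y0 yx.
have m0 : 0 < Num.max x r by rewrite lt_max r0 orbT.
rewrite ge0_ler_powR ?nnegrE ?divr_ge0 ?(ltW a0) ?(ltW r0) ?(ltW m0) ?(ltW y0)//.
by rewrite ler_pM2l// lef_pV2 ?posrE.
Qed.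

(** A step [h] of at most [u / (2 * (1 + a))], possibly very negative, is handled by expanding
    around [u]. A larger one is paid for by the last term alone, as in Markov's inequality. Powers
    [1 + b] of [|h|] are replaced by [1] plus the power [1 + a], the only absolute moment whose
    bound is available. *)
Lemma crossing_bound_step a b r u h :
  0 < a -> 0 < b <= 1 -> b <= a -> 1 <= r -> r <= u ->
  crossing_bound a r (u - h) <=
    crossing_bound a r u *
      (1 + a * (h / u) +
       2 * a * (1 + a) * ((1 + `|h| `^ (1 + a)) / u `^ (1 + b))) +
    (2 * (1 + a)) `^ (1 + a) * (`|h| `^ (1 + a) / u `^ (1 + a)).
Proof.
move=> a0 /andP[b0 b1] ba r1 ru.
have r0 : 0 < r by lra.
have u0 : 0 < u by lra.
have K0 : 0 < 2 * a * (1 + a) by rewrite !mulr_gt0//; lra.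
have Gu : crossing_bound a r u = (r / u) `^ a by rewrite /crossing_bound max_l.
have divN c : `|h / u| `^ c = `|h| `^ c / u `^ c.
  by rewrite normrM normfV (gtr0_norm u0) powR_div// ltW.
have last0 : 0 <= (2 * (1 + a)) `^ (1 + a) * (`|h| `^ (1 + a) / u `^ (1 + a)).
  by rewrite mulr_ge0 ?powR_ge0// divr_ge0 ?powR_ge0.
have hh : `|h / u| `^ (1 + b) <= (1 + `|h| `^ (1 + a)) / u `^ (1 + b).
  rewrite divN.
  rewrite ler_pM2r ?invr_gt0 ?powR_gt0//.
  have [h1|h1] := leP `|h| 1.
    apply: (@le_trans _ _ 1); last by rewrite lerDl powR_ge0.
    by apply: powR_le1 => //; lra.
  apply: (@le_trans _ _ (`|h| `^ (1 + a))); last by rewrite lerDr ler01.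
  by apply: ler_powR; [exact: ltW|lra].
have [z1|z1] := leP (2 * (1 + a) * (h / u)) 1.
  have z0 : 0 < 1 - h / u.
    have [zn|zp] := leP (h / u) 0; first by lra.
    have : 0 < a * (h / u) by rewrite mulr_gt0.
    by lra.
  have E : u - h = u * (1 - h / u) by field; lra.
  have w0 : 0 < u - h by rewrite E mulr_gt0.
  rewrite -[leLHS]addr0 lerD// Gu.
  apply: (@le_trans _ _ ((r / (u - h)) `^ a)).
    by apply: crossing_bound_le => //; rewrite le_max lexx.
  have -> : r / (u - h) = (r / u) * (1 - h / u)^-1.
    by rewrite E; field; apply/andP; split; lra.
  rewrite powRM ?divr_ge0 ?invr_ge0 ?(ltW r0) ?(ltW u0) ?(ltW z0)//.
  rewrite ler_wpM2l ?powR_ge0//.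
  apply: (le_trans (@powR_inv1B_le_quad a b _ a0 _ z1)); first by rewrite b0.
  by rewrite lerD2l ler_wpM2l// ltW.
(* Large upward step: the crossing bound never exceeds [1], and here the last term is at least
   [1]. *)
apply: (@le_trans _ _ 1); first exact: crossing_bound_le1.
have z0 : 0 < h / u.
  rewrite ltNge; apply/negP => zn.
  by have := mulr_ge0_le0 (ltW a0) zn; lra.
rewrite -[leLHS]add0r lerD//.
  rewrite mulr_ge0 ?crossing_bound_ge0//.
  have : 0 < a * (h / u) by rewrite mulr_gt0.
  have : 0 <= 2 * a * (1 + a) * ((1 + `|h| `^ (1 + a)) / u `^ (1 + b)).
    by rewrite mulr_ge0 ?(ltW K0)// divr_ge0 ?powR_ge0// addr_ge0 ?powR_ge0.
  by lra.
rewrite -divN.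
rewrite -powRM//; last by lra.
by apply: powR_ge1; [lra|rewrite gtr0_norm// ltW].
Qed.

(* From height [u >= r] on, the drift [- e] outweighs the error terms of
   [crossing_bound_step] for steps whose moment of order [1 + a] is at most [M]. *)
Definition drift_barrier a b e M r : Prop := forall u, r <= u ->
  crossing_bound a r u *
    (1 - a * (e / u) + 2 * a * (1 + a) * ((1 + M) / u `^ (1 + b))) +
  (2 * (1 + a)) `^ (1 + a) * (M / u `^ (1 + a)) <= crossing_bound a r u.

Lemma powR_ge_root x y c : 0 < c -> 0 <= x -> x `^ c^-1 <= y -> x <= y `^ c.
Proof.
move=> c0 x0 xy; rewrite -[leLHS](powRr1 x0) -(mulVf (lt0r_neq0 c0)) powRrM.
by rewrite ge0_ler_powR ?nnegrE ?powR_ge0 ?(ltW c0)// (le_trans _ xy)// powR_ge0.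
Qed.

(** After multiplication by [u * u ^ a], the drift gains [r ^ a * a * e], against a second-order
    loss that shrinks like [u ^ (- b)] relative to this gain and a loss from large steps that does
    not depend on [r]. A large [r] beats both. *)
Lemma exists_drift_barrier a e M : 0 < a -> 0 < e -> 0 <= M ->
  exists2 r, 1 <= r /\ e <= r &
  exists2 b, 0 < b <= 1 /\ b <= a & drift_barrier a b e M r.
Proof.
move=> a0 e0 M0.
(* The bound by [1] lets a square be dominated by a power [1 + b] near [0]; the bound by [a] keeps
   that power within the moment of order [1 + a]. *)
pose b := Num.min a 1.
have b0 : 0 < b by rewrite /b lt_min a0 ltr01.
have ba : b <= a by rewrite /b ge_min lexx.
have b1 : b <= 1 by rewrite /b ge_min lexx orbT.
have ae : 0 < a * e by rewrite mulr_gt0.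
(* Each of the two losses is at most half of the gain once [u ^ b >= A] and [r ^ a >= B]. *)
pose A := 2 * (2 * a * (1 + a) * (1 + M)) / (a * e).
pose B := 2 * ((2 * (1 + a)) `^ (1 + a) * M) / (a * e).
have A0 : 0 <= A by rewrite /A divr_ge0 ?(ltW ae)// !mulr_ge0//; lra.
have B0 : 0 <= B by rewrite /B divr_ge0 ?(ltW ae)// !mulr_ge0 ?powR_ge0.
pose r := 1 + e + A `^ b^-1 + B `^ a^-1.
have pA := powR_ge0 A b^-1; have pB := powR_ge0 B a^-1.
have r1 : 1 <= r by rewrite /r; lra.
exists r; first by split => //; rewrite /r; lra.
exists b; first by rewrite b0.
move=> u ru.
have r0 : 0 < r by lra.
have u0 : 0 < u by lra.
have -> : crossing_bound a r u = (r / u) `^ a by rewrite /crossing_bound max_l.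
have uD c : u `^ (1 + c) = u * u `^ c.
  by rewrite powRD ?powRr1 ?(ltW u0)//; apply/implyP => _; rewrite gt_eqF.
have -> : (r / u) `^ a = r `^ a / u `^ a.
  by rewrite powR_div// ltW.
have Ab : A <= u `^ b by apply: powR_ge_root => //; rewrite (le_trans _ ru)// /r; lra.
have Ba : B <= r `^ a by apply: powR_ge_root => //; rewrite /r; lra.
have ub : 0 < u `^ b by rewrite powR_gt0.
have ua : 0 < u `^ a by rewrite powR_gt0.
have ra : 0 < r `^ a by rewrite powR_gt0.
rewrite !uD.
set C := (2 * (1 + a)) `^ (1 + a) in B B0 pB r r1 ru r0 pA Ba ra *.
set K := 2 * a * (1 + a) in A A0 B B0 pB r r1 ru r0 pA Ba ra Ab *.
move: Ab; rewrite /A ler_pdivrMr// => Ab.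
move: Ba; rewrite /B ler_pdivrMr// => Ba.
rewrite -subr_ge0.
have -> : r `^ a / u `^ a -
   (r `^ a / u `^ a * (1 - a * (e / u) + K * ((1 + M) / (u * u `^ b))) +
    C * (M / (u * u `^ a))) =
   (r `^ a * (a * e - K * (1 + M) / u `^ b) - C * M) / (u * u `^ a).
  by field; rewrite !gt_eqF.
rewrite divr_ge0 ?mulr_ge0 ?(ltW u0) ?(ltW ua)//.
have k1 : K * (1 + M) / u `^ b <= a * e / 2 by rewrite ler_pdivrMr//; lra.
have : r `^ a * (a * e / 2) <= r `^ a * (a * e - K * (1 + M) / u `^ b).
  by rewrite ler_wpM2l ?(ltW ra)//; lra.
by lra.
Qed.

End RealInequalities.

(** * Sums of powers *)

Section PowerSums.
Context {R : realType}.
Implicit Types q x : R.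

(** Young's inequality with exponents [q] and [q / (q - 1)], applied to the [q]-th root of [1 - x]
    and to [1]. *)
Lemma powR_root1B_le q x : 1 < q -> 0 <= x <= 1 -> (1 - x) `^ q^-1 <= 1 - x / q.
Proof.
move=> q1 /andP[x0 x1].
have q0 : 0 < q by lra.
have p0 : 0 < q / (q - 1) by rewrite divr_gt0//; lra.
have pq : q^-1 + (q / (q - 1))^-1 = 1 by field; apply/andP; split; lra.
have := conjugate_powR (powR_ge0 (1 - x) q^-1) (@ler01 R) q0 p0 pq.
rewrite mulr1 -powRrM mulVf ?gt_eqF// powRr1 ?subr_ge0// powR1.
move=> /le_trans; apply; rewrite mul1r mulrBl mul1r.
by move: pq; set i := q^-1; set j := (q / (q - 1))^-1; lra.
Qed.

(** The previous inequality at [x = 1 / (n + 1)] shows that each term is at most the increment of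
    the right side. *)
Lemma sum_powR_le q n : 1 < q ->
  \sum_(1 <= t < n.+1) t%:R `^ (q^-1 - 1) <= q * n%:R `^ q^-1.
Proof.
move=> q1; have q0 : 0 < q by lra.
elim: n => [|n IHn]; first by rewrite big_geq// mulr_ge0 ?powR_ge0// ltW.
rewrite big_nat_recr//=.
have n0 : (0 : R) < n.+1%:R by rewrite ltr0n.
rewrite powRB; last by apply/implyP => _; rewrite gt_eqF.
rewrite powRr1 ?ler0n//.
have x01 : 0 <= (n.+1%:R : R)^-1 <= 1.
  by rewrite invr_ge0 ler0n/= invf_le1// ler1n.
have := powR_root1B_le q1 x01.
have e1 : (n%:R : R) = n.+1%:R * (1 - n.+1%:R^-1).
  by rewrite mulrBr mulr1 divff ?gt_eqF// -natr1 addrK.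
have p0 : 0 <= (n.+1%:R : R) `^ q^-1 by exact: powR_ge0.
move=> /(ler_wpM2l p0); rewrite -powRM ?ler0n//; last by rewrite subr_ge0; case/andP: x01.
rewrite -e1 => /(ler_wpM2l (ltW q0)) h.
apply: le_trans (lerD IHn (lexx _)) _.
apply: le_trans (lerD h (lexx _)) _.
rewrite le_eqVlt; apply/orP; left; apply/eqP; field.
by rewrite !gt_eqF.
Qed.

(** Each [f i] is at most the [q]-th root of the sum of the [q]-th powers. The constant is cruder
    than the one from convexity, but only its finiteness matters. *)
Lemma powR_sum_le (I : Type) (s : seq I) (f : I -> R) q : 0 < q ->
  (forall i, 0 <= f i) ->
  (\sum_(i <- s) f i) `^ q <= (size s)%:R `^ q * \sum_(i <- s) f i `^ q.
Proof.
move=> q0 f0.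
set S := \sum_(i <- s) f i `^ q.
have S0 : 0 <= S by apply: sumr_ge0 => i _; exact: powR_ge0.
suff h : \sum_(i <- s) f i <= (size s)%:R * S `^ q^-1.
  apply: (@le_trans _ _ (((size s)%:R * S `^ q^-1) `^ q)).
    by rewrite ge0_ler_powR ?nnegrE ?(ltW q0) ?mulr_ge0 ?powR_ge0 ?sumr_ge0.
  by rewrite powRM ?powR_ge0// -powRrM mulVf ?gt_eqF// powRr1.
have mono (x y : R) : 0 <= x -> x <= y -> x `^ q^-1 <= y `^ q^-1.
  move=> x0 xy; rewrite ge0_ler_powR ?nnegrE ?invr_ge0 ?(ltW q0)//.
  exact: le_trans xy.
(* An arbitrary upper bound [T] replaces the sum of powers, so that the induction on [s] can keep it
   fixed. *)
suff h : forall T, \sum_(i <- s) f i `^ q <= T -> 0 <= T ->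
    \sum_(i <- s) f i <= (size s)%:R * T `^ q^-1 by exact: h (lexx _) S0.
elim: s {S S0} => [|i s IH] T; rewrite ?big_nil ?big_cons; first by rewrite mul0r.
move=> sT T0; have fi := powR_ge0 (f i) q.
have ss : 0 <= \sum_(j <- s) f j `^ q by apply: sumr_ge0 => j _; exact: powR_ge0.
rewrite /= -natr1 mulrDl mul1r addrC lerD ?IH//; first by lra.
have := mono (f i `^ q) T fi; rewrite -powRrM mulfV ?gt_eqF// powRr1//.
by apply; lra.
Qed.

End PowerSums.

(** * Integration against independent maps *)

Section IndependentIntegral.
Local Open Scope ereal_scope.
Context {d d1 d2 : measure_display} {O : measurableType d} {T1 : measurableType d1}
  {T2 : measurableType d2} {R : realType}.
Variable P : probability O R.

Definition independent_maps (U : O -> T1) (V : O -> T2) : Prop :=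
  forall A B, measurable A -> measurable B ->
    P (U @^-1` A `&` V @^-1` B) = P (U @^-1` A) * P (V @^-1` B).

(** Independence says that the joint law agrees with the product of the laws on rectangles, hence
    everywhere; Tonelli then applies. The iterated integral stands in for a conditional expectation
    given [U]. *)
Lemma ge0_integral_independent (U : {mfun O >-> T1}) (V : {mfun O >-> T2})
    (h : T1 * T2 -> \bar R) :
  independent_maps U V -> measurable_fun setT h -> (forall x, 0 <= h x) ->
  \int[P]_w h (U w, V w) = \int[P]_w \int[P]_z h (U w, V z).
Proof.
move=> UV mh h0.
have mUV : measurable_fun setT (fun w => (U w, V w)).
  exact: measurable_fun_pair.
pose UV' : {mfun O >-> (T1 * T2)%type} :=
  HB.pack (fun w => (U w, V w)) (isMeasurableFun.Build _ _ _ _ _ mUV).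
transitivity (\int[distribution P UV']_x h x).
  by rewrite ge0_integral_distribution.
transitivity (\int[distribution P U \x distribution P V]_x h x).
  apply/esym; apply: eq_measure_integral => A mA _.
  exact: product_measure_unique.
rewrite fubini_tonelli1// ge0_integral_distribution//.
- apply: eq_integral => w _ /=; rewrite /fubini_F ge0_integral_distribution//.
  exact: measurableT_comp.
- exact: measurable_fun_fubini_tonelli_F.
- by move=> x; apply: integral_ge0.
Qed.

Lemma measurable_integral_section (U : {mfun O >-> T1}) (V : {mfun O >-> T2})
    (h : T1 * T2 -> \bar R) :
  measurable_fun setT h -> (forall x, 0 <= h x) ->
  measurable_fun setT (fun w => \int[P]_z h (U w, V z)).
Proof.
move=> mh h0.
have mF : measurable_fun setT (fubini_F (distribution P V) h).
  exact: measurable_fun_fubini_tonelli_F.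
apply: (eq_measurable_fun (fubini_F (distribution P V) h \o U)).
  move=> w _ /=; rewrite /fubini_F ge0_integral_distribution//.
  exact: measurableT_comp.
exact: measurableT_comp.
Qed.

End IndependentIntegral.

(** * One random step: the supermartingale inequality *)

Section CrossingSupermartingale.
Context {d : measure_display} {O : measurableType d} {R : realType}.
Variable P : probability O R.

Lemma measurable_crossing_bound (a r : R) : 0 < r ->
  measurable_fun setT (crossing_bound a r).
Proof.
move=> r0; apply: (measurableT_comp (measurable_powR a)).
apply: (eq_measurable_fun (fun x : R => r * (Num.max x r) `^ (-1))).
  by move=> x _; rewrite powR_inv1// le_max (ltW r0) orbT.
apply: measurable_funM => //; apply: (measurableT_comp (measurable_powR _)).
exact: measurable_maxr.
Qed.

(** Below [r] the crossing bound is already [1], its maximum. From [r] on, the deterministic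
    one-step estimate is integrated: only the mean and the moment of order [1 + a] of [V] appear,
    and the drift condition closes the inequality. *)
Lemma integral_crossing_bound_step (a b e M r u : R) (V : O -> R) :
  0 < a -> 0 < b <= 1 -> b <= a -> 1 <= r ->
  drift_barrier a b e M r ->
  P.-integrable setT (EFin \o V) -> (\int[P]_w (V w)%:E = (- e)%:E)%E ->
  (\int[P]_w (`|V w| `^ (1 + a))%:E <= M%:E)%E ->
  (\int[P]_w (crossing_bound a r (u - V w))%:E <= (crossing_bound a r u)%:E)%E.
Proof.
move=> a0 b01 ba r1 hr iV EV MV.
have r0 : 0 < r by lra.
have mV : measurable_fun setT V by exact/measurable_EFinP/(measurable_int P).
have mG : measurable_fun setT (fun w => (crossing_bound a r (u - V w))%:E).
  apply/measurable_EFinP; apply: (measurableT_comp (measurable_crossing_bound a r0)).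
  exact: measurable_funB.
have [ur|ru] := ltP u r.
  rewrite (crossing_bound1 a r0 (ltW ur)).
  apply: (@le_trans _ _ (\int[P]_(w in setT) (cst 1%:E) w)%E).
    apply: ge0_le_integral => //.
    - by move=> x _; rewrite lee_fin crossing_bound_ge0.
    - by move=> x _; rewrite lee_fin /= crossing_bound_le1.
  by rewrite integral_cst//= probability_setT mule1.
have u0 : 0 < u by lra.
set g := crossing_bound a r u.
set K := 2 * a * (1 + a).
set C := (2 * (1 + a)) `^ (1 + a).
have K0 : 0 <= K by rewrite /K !mulr_ge0//; lra.
have C0 : 0 <= C by exact: powR_ge0.
have g0 : 0 <= g by exact: crossing_bound_ge0.
(* The one-step estimate rearranged as [c0 + c1 * V + c2 * |V| ^ (1 + a)]. *)
pose c0 := g * (1 + K / u `^ (1 + b)).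
pose c1 := g * (a / u).
pose c2 := g * (K / u `^ (1 + b)) + C / u `^ (1 + a).
have c20 : 0 <= c2.
  by apply: addr_ge0; [apply: mulr_ge0 g0 _|]; apply: divr_ge0 => //;
    exact: powR_ge0.
have mV2 : measurable_fun setT (fun w => `|V w| `^ (1 + a)).
  apply: (measurableT_comp (measurable_powR (1 + a))).
  exact: measurableT_comp.
have iV2 : P.-integrable setT (fun w => (`|V w| `^ (1 + a))%:E).
  apply/integrableP; split; first exact/measurable_EFinP.
  under eq_integral do rewrite gee0_abs ?lee_fin ?powR_ge0//.
  exact: le_lt_trans MV (ltry _).
have i0 : P.-integrable setT (EFin \o cst c0).
  exact: finite_measure_integrable_cst.
have i1 : P.-integrable setT (fun w => c1%:E * (V w)%:E)%E.
  exact: integrableZl.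
have i2 : P.-integrable setT (fun w => c2%:E * (`|V w| `^ (1 + a))%:E)%E.
  exact: integrableZl.
have i01 : P.-integrable setT (fun w => (c0%:E + c1%:E * (V w)%:E)%E).
  exact: (integrableD _ i0 i1).
apply: (@le_trans _ _ (\int[P]_w (c0%:E + c1%:E * (V w)%:E +
    c2%:E * (`|V w| `^ (1 + a))%:E))%E).
  apply: le_integral => //.
  - apply: (@measurable_bounded_integrable _ _ _ P _ setT) => //.
    + exact: le_lt_trans (probability_le1 P measurableT) (ltry _).
    + exact/measurable_EFinP.
    + exists 1; split => // x x1 w _ /=.
      by rewrite ger0_norm ?crossing_bound_ge0// (le_trans _ (ltW x1))// crossing_bound_le1.
  - exact: (integrableD _ i01 i2).
  move=> w _; rewrite -!EFinM -!EFinD lee_fin.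
  apply: le_trans (crossing_bound_step (V w) a0 b01 ba r1 ru) _.
  rewrite -/g -/K -/C le_eqVlt; apply/orP; left; apply/eqP.
  by rewrite /c0 /c1 /c2; ring.
rewrite integralD// integralD// !integralZl// EV.
have -> : (\int[P]_w (EFin \o cst c0) w = c0%:E)%E.
  by rewrite -[RHS]mule1 -(probability_setT P) -integral_cst.
apply: (@le_trans _ _ (c0%:E + c1%:E * (- e)%:E + c2%:E * M%:E)%E).
  by rewrite leeD2l// lee_wpmul2l// lee_fin.
rewrite -!EFinM -!EFinD lee_fin; apply: le_trans (hr u ru).
rewrite -/g -/K -/C le_eqVlt; apply/orP; left; apply/eqP.
by rewrite /c0 /c1 /c2; ring.
Qed.

End CrossingSupermartingale.

(** * The filtration of the edge costs and its independence from the next round *)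

Section Filtration.
Context {dsp : measure_display} {Omega : measurableType dsp} {R : realType}.
Context {P : probability Omega R} {m : nat}.
Variable W : nat -> 'I_m -> {RV P >-> R}.

Definition borel_cylinders : set (set ('I_m -> R)) :=
  [set [set x : 'I_m -> R | A (x e)] | e in [set: 'I_m] & A in measurable].

(** Generates the sigma-algebra of all edge costs up to time [n], which is finer than what the
    policy observes. Constraining all rounds at once makes the family closed under intersection; for
    [n = 0] it contains only the whole space. *)
Definition past_cylinders (n : nat) : set (set Omega) :=
  [set F | exists2 A : nat -> set ('I_m -> R), forall t, borel_vec (A t) &
     F = \bigcap_(t in [set t | (0 < t <= n)%N]) (cost_vector W t @^-1` A t)].

Local Notation vec := (g_sigma_algebraType borel_cylinders).
Local Notation past n := (g_sigma_algebraType (past_cylinders n)).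

Lemma borel_vecI (A B : set ('I_m -> R)) :
  borel_vec A -> borel_vec B -> borel_vec (A `&` B).
Proof. exact: (@measurableI _ vec). Qed.

Lemma borel_vecT : borel_vec [set: 'I_m -> R].
Proof. exact: (@measurableT _ vec). Qed.

Lemma measurable_coordinate (e : 'I_m) :
  measurable_fun setT ((fun x => x e) : vec -> R).
Proof.
move=> _ A mA; rewrite setTI; apply: sub_sigma_algebra.
by exists e => //; exists A.
Qed.

Lemma measurable_cost_vector t A :
  borel_vec A -> measurable (cost_vector W t @^-1` A).
Proof.
move=> bA; rewrite -[X in measurable X]setTI.
have : measurable_fun setT (cost_vector W t : Omega -> vec).
  apply: (@measurability _ _ _ vec setT (cost_vector W t : Omega -> vec) borel_cylinders erefl).
  move=> _ [_ [e _ [B mB <-]] <-].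
  exact: (measurable_funP (W t e)).
by move=> /(_ measurableT); apply.
Qed.

Lemma past_cylinders_setI n : setI_closed (past_cylinders n).
Proof.
move=> _ _ [A bA ->] [B bB ->]; exists (fun t => A t `&` B t).
  by move=> t; exact: borel_vecI.
by rewrite -bigcapI.
Qed.

Lemma past_cylinders_measurable n : past_cylinders n `<=` measurable.
Proof.
move=> _ [A bA ->]; apply: bigcap_measurableType => t _.
exact: measurable_cost_vector.
Qed.

Lemma past_measurable n : <<s past_cylinders n >> `<=` (measurable : set (set Omega)).
Proof.
apply: smallest_sub; first exact: sigma_algebra_measurable.
exact: past_cylinders_measurable.
Qed.

Lemma past_measurable_fun n d1 (T1 : measurableType d1) (f : Omega -> T1) :
  measurable_fun setT (f : past n -> T1) -> measurable_fun setT f.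
Proof. by move=> mf _ A mA; apply: past_measurable; exact: mf. Qed.

Lemma past_mono n k : (n <= k)%N -> <<s past_cylinders n >> `<=` <<s past_cylinders k >>.
Proof.
move=> nk; apply: smallest_sub; first exact: smallest_sigma_algebra.
move=> _ [A bA ->]; apply: sub_sigma_algebra.
exists (fun t => if (t <= n)%N then A t else setT).
  by move=> t; case: ifP => // _; exact: borel_vecT.
apply/seteqP; split => w /= hw t /=.
  by move=> /andP[t0 tk]; case: ifP => // tn; apply: hw => /=; rewrite t0.
move=> /andP[t0 tn]; have := hw t; rewrite /= t0 tn (leq_trans tn nk).
exact.
Qed.

Lemma past_mono_fun n k d1 (T1 : measurableType d1) (f : Omega -> T1) :
  (n <= k)%N -> measurable_fun setT (f : past n -> T1) ->
  measurable_fun setT (f : past k -> T1).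
Proof. by move=> nk mf _ A mA; apply: (past_mono nk); exact: mf. Qed.

Lemma cost_past_measurable t e : (0 < t)%N ->
  measurable_fun setT (W t e : past t -> R).
Proof.
move=> t0 _ A mA; rewrite setTI; apply: sub_sigma_algebra.
exists (fun k => if k == t then [set x : 'I_m -> R | A (x e)] else setT).
  move=> k; case: ifP => _; last exact: borel_vecT.
  by apply: sub_sigma_algebra; exists e => //; exists A.
apply/seteqP; split => w /=.
  by move=> Aw k /= _; case: eqP => // ->.
by move=> /(_ t) /=; rewrite t0 leqnn eqxx; exact.
Qed.

(** Dynkin's argument: the events independent of [V] form a lambda-system, and it contains the
    cylinders, which are stable under intersection. *)
Lemma past_independent n F A : iid_costs W ->
  <<s past_cylinders n >> F -> borel_vec A ->
  (P (F `&` cost_vector W n.+1 @^-1` A) = P F * P (cost_vector W n.+1 @^-1` A))%E.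
Proof.
move=> [_ indep] pF bA; set V := cost_vector W n.+1 @^-1` A.
have mV : measurable V by exact: measurable_cost_vector.
suff : <<s past_cylinders n >> `<=`
    [set F | measurable F /\ (P (F `&` V) = P F * P V)%E].
  by move=> /(_ F pF) [].
apply: lambda_system_subset => //; first exact: past_cylinders_setI.
  apply/dynkin_lambda_system; split.
  - split; first exact: measurableT.
    by rewrite setTI probability_setT mul1e.
  - move=> G [mG PG]; split; first exact: measurableC.
    have fV : P V \is a fin_num by exact: fin_num_measure.
    have fG : P G \is a fin_num by exact: fin_num_measure.
    have e1 : (P (~` G `&` V) = P V - P (G `&` V))%E.
      by rewrite setIC -setDE setIC measureD ?(lt_le_trans _ _)// -?ge0_fin_numE.
    by rewrite e1 PG probability_setC// muleBl// mul1e.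
  - move=> G tG hG; have mG k : measurable (G k) by case: (hG k).
    split; first exact: bigcup_measurable.
    rewrite setI_bigcupl measure_bigcup//; last 2 first.
    + by move=> k _; exact: measurableI.
    + exact: trivIset_setIr.
    rewrite measure_bigcup//.
    have fV : P V \is a fin_num by exact: fin_num_measure.
    rewrite muleC -[X in (X * _)%E](fineK fV) -nneseriesZl//.
    by apply: eq_eseriesr => k _; rewrite fineK// muleC; case: (hG k).
move=> G pG; split; first exact: past_cylinders_measurable pG.
case: pG => B bB ->.
pose J := [fset x in iota 1 n]%fset.
have JE t : (t \in J) = (0 < t <= n)%N.
  by rewrite /J !inE mem_iota add1n ltnS.
have J0 : 0%N \notin J by rewrite JE.
have Jn : n.+1 \notin J by rewrite JE ltnn andbF.
(* A cylinder intersected with [V] is again a finite intersection over rounds, with round [n.+1]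
   added, so the product formula applies to both. *)
pose B' t := if t == n.+1 then A else B t.
have bB' t : borel_vec (B' t) by rewrite /B'; case: ifP.
have JJ : \bigcap_(t in [set t | (0 < t <= n)%N]) (cost_vector W t @^-1` B t) =
          \bigcap_(t in [set` J]) (cost_vector W t @^-1` B t).
  by congr (\bigcap_(t in _) _); apply/seteqP; split => t /=; rewrite JE.
rewrite JJ (indep J B J0 bB).
have -> : \bigcap_(t in [set` J]) (cost_vector W t @^-1` B t) `&` V =
   \bigcap_(t in [set` (n.+1 |` J)%fset]) (cost_vector W t @^-1` B' t).
  apply/seteqP; split => w /=.
    move=> [wB wV] t /=; rewrite in_fset1U /B'.
    by case: eqP => [->|_] //= tJ; exact: wB.
  move=> wB; split.
    move=> t /= tJ; have := wB t; rewrite /= in_fset1U tJ orbT /B'.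
    by case: eqP => [tn|_]; [move: tJ; rewrite tn (negbTE Jn)|exact].
  by have := wB n.+1; rewrite /= in_fset1U eqxx /B' eqxx; exact.
rewrite (indep (n.+1 |` J)%fset B') //; last by rewrite in_fset1U negb_or J0.
rewrite big_fsetU1//= /B' eqxx muleC; congr (_ * _)%E.
rewrite big_seq [RHS]big_seq; apply: eq_bigr => t tJ.
by case: eqP => // tn; move: tJ; rewrite tn (negbTE Jn).
Qed.

Lemma past_independent_maps n d1 (T1 : measurableType d1) (U : Omega -> T1)
    (g : ('I_m -> R) -> R) : iid_costs W ->
  measurable_fun setT (U : past n -> T1) -> measurable_fun setT (g : vec -> R) ->
  independent_maps P U (g \o cost_vector W n.+1).
Proof.
move=> iid mU mg A B mA mB.
apply: (@past_independent n (U @^-1` A) (g @^-1` B)) => //.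
  by rewrite -[X in <<s _ >> X]setTI; exact: mU.
by rewrite -[X in borel_vec X]setTI; exact: mg.
Qed.

Variable X : nat -> Omega -> epath m.

Lemma path_cost_past_measurable t p : (0 < t)%N ->
  measurable_fun setT (path_cost W t p : past t -> R).
Proof.
by move=> t0; apply: measurable_sum => e; exact: cost_past_measurable.
Qed.

(** Strong induction: an observation at [j < t] combines the choice at [j], known from the earlier
    costs by induction, with the cost of a fixed path at [j]. Hence the choice at [t] is determined
    by the costs up to [t.-1]. *)
Lemma policy_past t p : policy W X -> (0 < t)%N ->
  <<s past_cylinders t.-1 >> [set w | X t w = p].
Proof.
move=> pol; elim/ltn_ind: t p => t IH p t0.
apply: (smallest_sub _ _ (pol t p t0)); first exact: smallest_sigma_algebra.
move=> _ [j [p' [U [/andP[j0 jt] mU ->]]]].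
have mX : <<s past_cylinders j >> [set w | X j w = p'].
  by apply: (past_mono (leq_pred j)); exact: IH.
have mC := path_cost_past_measurable p' j0.
have jt' : (j <= t.-1)%N by rewrite -ltnS prednK.
apply: (past_mono jt').
have := mC measurableT _ mU; rewrite setTI => mC'.
exact: (@measurableI _ (past j)).
Qed.

Lemma policy_past_indic t p : policy W X -> (0 < t)%N ->
  measurable_fun setT ((fun w => (X t w == p)%:R) : past t.-1 -> R).
Proof.
move=> pol t0.
have -> : (fun w => (X t w == p)%:R) = (\1_[set w | X t w = p] : past t.-1 -> R).
  apply/funext => w; rewrite indicE; congr (_%:R); congr nat_of_bool.
  by apply/eqP/idP; rewrite inE.
by apply: measurable_indic; exact: policy_past.
Qed.

End Filtration.

(** * Expectation of a product of independent variables *)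

Section ProductExpectation.
Context {d : measure_display} {O : measurableType d} {R : realType}.
Variable P : probability O R.

Lemma ge0_integral_independentM (U V : {mfun O >-> R}) (k : R -> R) :
  independent_maps P U V -> (forall w, 0 <= U w) ->
  measurable_fun setT k -> (forall x, 0 <= k x) ->
  (\int[P]_w (U w * k (V w))%:E =
   (\int[P]_w (U w)%:E) * (\int[P]_w (k (V w))%:E))%E.
Proof.
move=> UV U0 mk k0.
have mkV : measurable_fun setT (fun w => (k (V w))%:E).
  by apply/measurable_EFinP; exact: measurableT_comp.
have ik0 : (0 <= \int[P]_w (k (V w))%:E)%E.
  by apply: integral_ge0 => w _; rewrite lee_fin.
(* The absolute value makes [h] nonnegative on all pairs; it changes nothing on the values of
   [U]. *)
pose h (x : R * R) := (`|x.1| * k x.2)%:E.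
have mh : measurable_fun setT h.
  apply/measurable_EFinP; apply: measurable_funM.
    exact: measurableT_comp.
  exact: measurableT_comp.
have h0 x : (0 <= h x)%E by rewrite lee_fin mulr_ge0.
have := ge0_integral_independent UV mh h0.
rewrite /h /= => E.
transitivity (\int[P]_w (`|U w| * k (V w))%:E)%E.
  by apply: eq_integral => w _; rewrite ger0_norm.
rewrite E -ge0_integralZr//; last 2 first.
- exact/measurable_EFinP.
- by move=> w _; rewrite lee_fin.
apply: eq_integral => w _; rewrite ger0_norm//.
under eq_integral do rewrite EFinM.
by rewrite ge0_integralZl// ?lee_fin// => z _; rewrite lee_fin.
Qed.

(** The nonnegative case is applied to the positive and negative parts of [V]; all integrability
    comes from domination by [|V|], as [U] lies in [[0, 1]]. *)
Lemma integral_independentM (U V : {mfun O >-> R}) :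
  independent_maps P U V -> (forall w, 0 <= U w <= 1) ->
  P.-integrable setT (EFin \o V) ->
  P.-integrable setT (fun w => (U w * V w)%:E) /\
  (\int[P]_w (U w * V w)%:E = (\int[P]_w (U w)%:E) * (\int[P]_w (V w)%:E))%E.
Proof.
move=> UV U01 iV.
have U0 w : 0 <= U w by case/andP: (U01 w).
have U1 w : U w <= 1 by case/andP: (U01 w).
have dom (k : R -> R) : measurable_fun setT k -> (forall x, `|k x| <= `|x|) ->
    P.-integrable setT (fun w => (U w * k (V w))%:E).
  move=> mk kV; apply: le_integrable iV => //.
    apply/measurable_EFinP; apply: measurable_funM => //.
    exact: measurableT_comp.
  move=> w _; rewrite /= lee_fin normrM (ger0_norm (U0 w)).
  by rewrite -[leRHS]mul1r ler_pM.
pose kp (x : R) := Num.max x 0; pose kn (x : R) := Num.max (- x) 0.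
have mp : measurable_fun setT kp by exact: measurable_maxr.
have mn : measurable_fun setT kn.
  by apply: measurable_maxr => //; exact: measurableT_comp.
have kp0 x : 0 <= kp x by rewrite /kp le_max lexx orbT.
have kn0 x : 0 <= kn x by rewrite /kn le_max lexx orbT.
have kpn x : x = kp x - kn x.
  rewrite /kp /kn; case: (lerP x 0) => [x0|/ltW x0].
    by rewrite max_l ?oppr_ge0// sub0r opprK.
  by rewrite max_r ?oppr_le0// subr0.
have kpV x : `|kp x| <= `|x|.
  by rewrite ger0_norm// /kp ge_max ler_norm normr_ge0.
have knV x : `|kn x| <= `|x|.
  by rewrite ger0_norm// /kn ge_max -normrN ler_norm normr_ge0.
have domV (k : R -> R) : measurable_fun setT k -> (forall x, `|k x| <= `|x|) ->
    P.-integrable setT (fun w => (k (V w))%:E).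
  move=> mk kV; apply: le_integrable iV => //.
    by apply/measurable_EFinP; exact: measurableT_comp.
  by move=> w _; rewrite /= lee_fin.
split; first exact: (dom id).
transitivity (\int[P]_w ((U w * kp (V w))%:E - (U w * kn (V w))%:E))%E.
  by apply: eq_integral => w _; rewrite -EFinB -mulrBr -kpn.
rewrite integralB_EFin//; [|exact: dom|exact: dom].
rewrite !ge0_integral_independentM//.
have fU : (\int[P]_w (U w)%:E)%E \is a fin_num.
  apply: integrable_fin_num => //.
  apply: (@measurable_bounded_integrable _ _ _ P (U : O -> R) setT) => //.
    exact: le_lt_trans (probability_le1 P measurableT) (ltry _).
  exists 1; split => // x x1 w _ /=.
  by rewrite ger0_norm// (le_trans (U1 w))// ltW.
rewrite -muleBr//; last first.
  by rewrite fin_num_adde_defr//; apply: integrable_fin_num => //; exact: domV.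
congr (_ * _)%E; rewrite -integralB_EFin//; [|exact: domV|exact: domV].
by apply: eq_integral => w _; rewrite -EFinB -kpn.
Qed.

End ProductExpectation.

(** * Means and moments of path costs in terms of the marginals *)

Section PathMoments.
Context {R : realType} {m : nat}.
Variables (mu : 'I_m -> probability R R) (q : R).

Definition path_mean (p : epath m) : R := \sum_(e <- p) \int[mu e]_x x.

Definition path_moment (p : epath m) : R :=
  \sum_(e <- p) \int[mu e]_x (`|x| `^ q).

Lemma path_moment_ge0 p : 0 <= path_moment p.
Proof.
by apply: sumr_ge0 => e _; apply: Rintegral_ge0 => x _; exact: powR_ge0.
Qed.

(** The crude bound on the power of a sum, for [(size p).+1] terms: the constant
    [|path_mean p| + eps] and the edge costs. It depends on the marginals only, not on the
    probability space. *)
Definition increment_moment_bound (eps : R) (p : epath m) : R :=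
  (size p).+1%:R `^ q * ((`|path_mean p| + eps) `^ q + path_moment p).

Lemma increment_moment_bound_ge0 eps p : 0 <= increment_moment_bound eps p.
Proof. by rewrite mulr_ge0 ?powR_ge0// addr_ge0 ?powR_ge0 ?path_moment_ge0. Qed.

Context {dsp : measure_display} {Omega : measurableType dsp}.
Context {P : probability Omega R}.
Variable W : nat -> 'I_m -> {RV P >-> R}.
Hypothesis q1 : 1 < q.
Hypothesis margW : marginals W mu.
Hypothesis momW : forall t e, (0 < t)%N ->
  ('E_P[fun w => (`|W t e w| `^ q)%R] < +oo)%E.

Lemma ge0_integral_cost t e (f : R -> \bar R) : (0 < t)%N ->
  measurable_fun setT f -> (forall x, 0 <= f x)%E ->
  (\int[P]_w f (W t e w) = \int[mu e]_x f x)%E.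
Proof.
move=> t0 mf f0; rewrite -(ge0_integral_distribution (W t e) mf f0).
by apply: eq_measure_integral => A mA _; exact: margW.
Qed.

Lemma measurable_abs_powR : measurable_fun setT (fun x : R => `|x| `^ q).
Proof. exact: (measurableT_comp (measurable_powR q)). Qed.

Lemma integral_cost_moment t e : (0 < t)%N ->
  (\int[P]_w (`|W t e w| `^ q)%:E = (\int[mu e]_x (`|x| `^ q))%:E)%E.
Proof.
move=> t0; have mf : measurable_fun setT (fun x : R => (`|x| `^ q)%:E).
  by apply/measurable_EFinP; exact: measurable_abs_powR.
have f0 (x : R) : (0 <= (`|x| `^ q)%:E)%E by rewrite lee_fin powR_ge0.
have E := ge0_integral_cost e t0 mf f0.
rewrite E /Rintegral fineK// ge0_fin_numE ?integral_ge0//.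
by rewrite -E; have := momW e t0; rewrite unlock.
Qed.

Lemma cost_integrable t e : (0 < t)%N ->
  P.-integrable setT (EFin \o W t e).
Proof.
move=> t0.
have i2 : P.-integrable setT (fun w => (1 + `|W t e w| `^ q)%:E).
  have i1 : P.-integrable setT (EFin \o cst (1 : R)).
    exact: finite_measure_integrable_cst.
  have i3 : P.-integrable setT (fun w => (`|W t e w| `^ q)%:E).
    apply/integrableP; split.
      apply/measurable_EFinP; apply: (measurableT_comp measurable_abs_powR).
      exact: measurable_funP.
    under eq_integral do rewrite gee0_abs ?lee_fin ?powR_ge0//.
    by rewrite integral_cost_moment// ltry.
  exact: (integrableD _ i1 i3).
apply: le_integrable i2 => //; first exact/measurable_EFinP/measurable_funP.
move=> w _; rewrite /= lee_fin [leRHS]ger0_norm ?addr_ge0 ?powR_ge0//.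
have [h|h] := leP `|W t e w| 1; first by have := powR_ge0 `|W t e w| q; lra.
by have := le1r_powR (ltW h) (ltW q1); lra.
Qed.

Lemma integral_cost t e : (0 < t)%N ->
  (\int[P]_w (W t e w)%:E = (\int[mu e]_x x)%:E)%E.
Proof.
move=> t0; have iW := cost_integrable e t0.
rewrite -(@integral_distribution _ _ _ _ _ P (W t e) EFin) //.
have E : (\int[distribution P (W t e)]_y y%:E = \int[mu e]_x x%:E)%E.
  by apply: eq_measure_integral => A mA _; exact: margW.
rewrite E /Rintegral fineK// -E integral_distribution//.
exact: integrable_fin_num.
Qed.

Lemma path_cost_integrable t p : (0 < t)%N ->
  P.-integrable setT (EFin \o path_cost W t p).
Proof.
move=> t0; have : P.-integrable setT (fun w => \sum_(e <- p) (W t e w)%:E)%E.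
  by apply: integrable_sum => // e _; exact: cost_integrable.
by apply: eq_integrable => // w _; rewrite /= /path_cost sumEFin.
Qed.

Lemma integral_path_cost t p : (0 < t)%N ->
  (\int[P]_w (path_cost W t p w)%:E = (path_mean p)%:E)%E.
Proof.
move=> t0; under eq_integral do rewrite /path_cost -sumEFin.
rewrite integral_sum//; last by move=> e; exact: cost_integrable.
by under eq_bigr do rewrite integral_cost//; rewrite sumEFin.
Qed.

Lemma integral_increment_moment_le (s eps : R) t p : (0 < t)%N ->
  `|s| = 1 -> 0 <= eps ->
  (\int[P]_w (`|s * (path_cost W t p w - path_mean p) - eps| `^ q)%:E <=
   (increment_moment_bound eps p)%:E)%E.
Proof.
move=> t0 s1 eps0; have q0 : 0 < q := lt_trans ltr01 q1.
have mW e : measurable_fun setT (fun w => `|W t e w| `^ q).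
  by apply: (measurableT_comp measurable_abs_powR); exact: measurable_funP.
have mC : measurable_fun setT (path_cost W t p).
  exact/measurable_EFinP/(measurable_int P (path_cost_integrable p t0)).
pose c := `|path_mean p| + eps.
have c0 : 0 <= c by rewrite addr_ge0.
pose S w : \bar R := (\sum_(e <- p) (`|W t e w| `^ q)%:E)%E.
have mWE e : measurable_fun setT (fun w => (`|W t e w| `^ q)%:E).
  exact/measurable_EFinP.
have WE0 e w : (0 <= (`|W t e w| `^ q)%:E)%E by rewrite lee_fin powR_ge0.
have mS : measurable_fun setT S by apply: emeasurable_sum => e; exact: mWE.
have S0 w : (0 <= S w)%E by apply: sume_ge0 => e _; exact: WE0.
have cq0 : (0 <= (c `^ q)%:E)%E by rewrite lee_fin powR_ge0.
have k0 : (0 <= ((size p).+1%:R `^ q : R)%:E)%E by rewrite lee_fin powR_ge0.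
have mcS : measurable_fun setT (fun w => (c `^ q)%:E + S w)%E.
  exact: emeasurable_funD.
have cS0 w : (0 <= (c `^ q)%:E + S w)%E by exact: adde_ge0.
apply: (@le_trans _ _ (\int[P]_w (((size p).+1%:R `^ q)%:E *
    ((c `^ q)%:E + S w)))%E); last first.
  rewrite ge0_integralZl// ge0_integralD// ge0_integral_sum//.
  under eq_bigr do rewrite integral_cost_moment//.
  have -> : (\int[P]_w (c `^ q)%:E = (c `^ q)%:E)%E.
    by rewrite -[RHS]mule1 -(probability_setT P) -integral_cst.
  by rewrite sumEFin -EFinD -EFinM.
apply: ge0_le_integral => //.
- apply/measurable_EFinP; apply: (measurableT_comp measurable_abs_powR).
  apply: measurable_funB => //; apply: measurable_funM => //.
  exact: measurable_funB.
- exact: measurable_funeM.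
move=> w _; rewrite /S sumEFin -EFinD -EFinM lee_fin.
(* The absolute values of the entries of [l] add up to an upper bound for the size of the
   increment. *)
pose l := c :: [seq W t e w | e <- p].
have sl : size l = (size p).+1 by rewrite /= size_map.
have := @powR_sum_le R R l (fun x => `|x|) q q0 (@normr_ge0 _ _).
rewrite sl !big_cons !big_map (ger0_norm c0); apply: le_trans.
rewrite ge0_ler_powR ?nnegrE ?(ltW q0) ?addr_ge0 ?sumr_ge0//.
apply: (@le_trans _ _ (`|path_cost W t p w| + `|path_mean p| + eps)).
  apply: le_trans (ler_normB _ _) _; rewrite (ger0_norm eps0) lerD2r.
  by rewrite normrM s1 mul1r; exact: ler_normB.
have := ler_norm_sum p (fun e => W t e w) xpredT.
by rewrite -/(path_cost W t p w) /c; lra.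
Qed.

End PathMoments.

(** * The drifted walk of one path under adaptive observation *)

Section Walk.
Context {dsp : measure_display} {Omega : measurableType dsp} {R : realType}.
Context {P : probability Omega R} {m : nat}.
Variables (mu : 'I_m -> probability R R) (q : R).
Variables (W : nat -> 'I_m -> {RV P >-> R}) (X : nat -> Omega -> epath m).
Hypothesis q1 : 1 < q.
Hypothesis iidW : iid_costs W.
Hypothesis margW : marginals W mu.
Hypothesis momW : forall t e, (0 < t)%N ->
  ('E_P[fun w => (`|W t e w| `^ q)%R] < +oo)%E.
Hypothesis polX : policy W X.

Local Notation past n := (g_sigma_algebraType (past_cylinders W n)).

(* With [s = 1] or [s = -1], this walk reaches [eps] times the number of
   observations of [p] as soon as the empirical mean of [p] errs by [2 * eps]
   in the direction [s]. *)
Definition walk (s eps : R) (p : epath m) (t : nat) (w : Omega) : R :=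
  \sum_(1 <= j < t.+1)
    (X j w == p)%:R * (s * (path_cost W j p w - path_mean mu p) - eps).

Lemma walkS s eps p t w :
  walk s eps p t.+1 w = walk s eps p t w +
    (X t.+1 w == p)%:R * (s * (path_cost W t.+1 p w - path_mean mu p) - eps).
Proof. by rewrite /walk big_nat_recr. Qed.

Lemma walk_past_measurable s eps p t :
  measurable_fun setT (walk s eps p t : past t -> R).
Proof.
elim: t => [|t IH].
  have -> : walk s eps p 0 = cst 0 by apply/funext => w; rewrite /walk big_geq.
  exact: measurable_cst.
have -> : walk s eps p t.+1 = (fun w => walk s eps p t w +
    (X t.+1 w == p)%:R * (s * (path_cost W t.+1 p w - path_mean mu p) - eps)).
  by apply/funext => w; rewrite walkS.
apply: measurable_funD; first exact: (past_mono_fun (leqnSn t)).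
apply: measurable_funM.
  apply: (past_mono_fun (leqnSn t)).
  exact: (policy_past_indic p polX (ltn0Sn t)).
apply: measurable_funB => //; apply: measurable_funM => //.
by apply: measurable_funB => //; exact: path_cost_past_measurable.
Qed.

Lemma walk_measurable s eps p t : measurable_fun setT (walk s eps p t).
Proof.
by apply: (past_measurable_fun (W := W) (n := t)); exact: walk_past_measurable.
Qed.

Lemma choice_indic_measurable t p : (0 < t)%N ->
  measurable_fun setT (fun w => (X t w == p)%:R : R).
Proof.
move=> t0; apply: (past_measurable_fun (W := W) (n := t.-1)).
exact: policy_past_indic.
Qed.

(** The position of the walk and the decision to observe [p] at [t.+1] are functions of the past,
    while the potential increment is independent of it. With the past frozen, the walk either stays
    put or makes one step of drift [- eps]. *)
Lemma integral_crossing_walk_step (s eps b r M x : R) p t :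
  `|s| = 1 -> 0 <= eps -> 0 < b <= 1 -> b <= q - 1 -> 1 <= r ->
  increment_moment_bound mu q eps p <= M ->
  drift_barrier (q - 1) b eps M r ->
  (\int[P]_w (crossing_bound (q - 1) r (x - walk s eps p t.+1 w))%:E <=
   \int[P]_w (crossing_bound (q - 1) r (x - walk s eps p t w))%:E)%E.
Proof.
move=> s1 eps0 b01 bq r1 MM hr.
have r0 : 0 < r by exact: lt_le_trans r1.
have a0 : 0 < q - 1 by rewrite subr_gt0.
pose g (v : 'I_m -> R) := s * (\sum_(e <- p) v e - path_mean mu p) - eps.
pose V w := s * (path_cost W t.+1 p w - path_mean mu p) - eps.
have iC := path_cost_integrable q1 margW momW p (ltn0Sn t).
have mC : measurable_fun setT (path_cost W t.+1 p).
  exact/measurable_EFinP/(measurable_int P iC).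
have mV : measurable_fun setT V.
  apply: measurable_funB => //; apply: measurable_funM => //.
  exact: measurable_funB.
pose V' : {mfun Omega >-> R} := HB.pack V (isMeasurableFun.Build _ _ _ _ _ mV).
pose U w : R * R := (walk s eps p t w, (X t.+1 w == p)%:R).
have mUp : measurable_fun setT (U : past t -> R * R).
  apply: measurable_fun_pair; first exact: walk_past_measurable.
  exact: (policy_past_indic p polX (ltn0Sn t)).
have mU : measurable_fun setT U.
  exact: (past_measurable_fun (W := W) (n := t)).
pose U' : {mfun Omega >-> (R * R)%type} :=
  HB.pack U (isMeasurableFun.Build _ _ _ _ _ mU).
have UV : independent_maps P U' V'.
  apply: (past_independent_maps (g := g) iidW mUp).
  apply: measurable_funB => //; apply: measurable_funM => //.
  apply: measurable_funB => //; apply: measurable_sum => e.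
  exact: measurable_coordinate.
pose h (z : (R * R) * R) :=
  (crossing_bound (q - 1) r (x - (z.1.1 + z.1.2 * z.2)))%:E.
have mG := measurable_crossing_bound (q - 1) r0.
have mh : measurable_fun setT h.
  apply/measurable_EFinP; apply: (measurableT_comp mG).
  apply: measurable_funB => //; apply: measurable_funD.
    exact: measurableT_comp.
  by apply: measurable_funM => //; exact: measurableT_comp.
have h0 z : (0 <= h z)%E by rewrite lee_fin crossing_bound_ge0.
rewrite (eq_integral (fun w => h (U' w, V' w))); last first.
  by move=> w _; rewrite walkS.
rewrite (ge0_integral_independent UV mh h0).
apply: ge0_le_integral => //.
- by move=> w _; apply: integral_ge0 => z _; exact: h0.
- exact: measurable_integral_section.
- apply/measurable_EFinP; apply: (measurableT_comp mG).
  by apply: measurable_funB => //; exact: walk_measurable.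
move=> w _; rewrite /h /U' /V' /U /=.
case: eqP => _ /=; last first.
  under eq_integral do rewrite mul0r addr0.
  by rewrite -[leRHS]mule1 -(probability_setT P) -integral_cst.
under eq_integral do rewrite mul1r opprD addrA.
apply: (integral_crossing_bound_step (b := b) (e := eps) (M := M)) => //.
- have : P.-integrable setT (fun w => (s%:E * (path_cost W t.+1 p w)%:E -
     (s * path_mean mu p + eps)%:E)%E).
    apply: integrableB => //; first exact: integrableZl.
    exact: finite_measure_integrable_cst.
  apply: eq_integrable => // z _; rewrite /= /V -EFinM -EFinB.
  by congr EFin; ring.
- transitivity (\int[P]_w (s%:E * (path_cost W t.+1 p w)%:E -
     (s * path_mean mu p + eps)%:E)%E)%E.
    apply: eq_integral => z _; rewrite /V -EFinM -EFinB.
    by congr EFin; ring.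
  rewrite integralB//; last 2 first.
  + exact: integrableZl.
  + exact: finite_measure_integrable_cst.
  rewrite integralZl// (integral_path_cost q1 margW momW)//.
  have -> : (\int[P]_w (s * path_mean mu p + eps)%:E =
             (s * path_mean mu p + eps)%:E)%E.
    by rewrite -[RHS]mule1 -(probability_setT P) -integral_cst.
  by rewrite -EFinM -EFinB; congr EFin; ring.
- have -> : 1 + (q - 1) = q by ring.
  apply: le_trans (integral_increment_moment_le q1 margW momW p _ s1 eps0) _ => //.
Qed.

(** The walk starts at [0], and the integrand is [1] wherever the walk is at least [x - r]; so this
    controls the probability of that event. *)
Lemma integral_crossing_walk_le (s eps b r M x : R) p t :
  `|s| = 1 -> 0 <= eps -> 0 < b <= 1 -> b <= q - 1 -> 1 <= r ->
  increment_moment_bound mu q eps p <= M ->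
  drift_barrier (q - 1) b eps M r ->
  (\int[P]_w (crossing_bound (q - 1) r (x - walk s eps p t w))%:E <=
   (crossing_bound (q - 1) r x)%:E)%E.
Proof.
move=> s1 eps0 b01 bq r1 MM hr; elim: t => [|t IH].
  under eq_integral do rewrite /walk big_geq// subr0.
  by rewrite -[leRHS]mule1 -(probability_setT P) -integral_cst.
by apply: le_trans IH; exact: integral_crossing_walk_step hr.
Qed.

End Walk.

(** * Counting exploration rounds *)

Section Exploration.
Context {R : realType}.
Variables v q : R.
Hypothesis v0 : 0 < v.
Local Notation A := (exploration v q).

Lemma explorationS t : (0 < t)%N ->
  A t.+1 = if #|` A t|%:R < v * t.+1%:R `^ q^-1 then (t.+1 |` A t)%fset else A t.
Proof. by case: t. Qed.

Lemma card_exploration0 : #|` A 0| = 0%N.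
Proof. exact: cardfs0. Qed.

Lemma card_exploration1 : #|` A 1| = 1%N.
Proof. exact: cardfs1. Qed.

Lemma exploration1 : 1%N \in A 1.
Proof. by rewrite in_fset1. Qed.

Lemma exploration_le t j : j \in A t -> (j <= t)%N.
Proof.
elim: t => [|[|t] IH]; first by rewrite in_fset0.
  by rewrite in_fset1 => /eqP ->.
rewrite explorationS//; case: ifP => _; last by move/IH => /leqW.
by rewrite in_fset1U => /orP[/eqP ->//|/IH/leqW].
Qed.

Lemma exploration_notin t : t.+1 \notin A t.
Proof. by apply/negP => /exploration_le; rewrite ltnn. Qed.

Lemma card_explorationS t : #|` A t.+1| = (#|` A t| + (t.+1 \in A t.+1))%N.
Proof.
case: t => [|t]; first by rewrite card_exploration1 card_exploration0 exploration1.
rewrite explorationS//; case: ifP => _.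
  by rewrite cardfsU1 exploration_notin in_fset1U eqxx addnC.
by rewrite (negbTE (exploration_notin _)) addn0.
Qed.

Lemma exploration_skip t : (0 < t)%N -> t \notin A t ->
  v * t%:R `^ q^-1 <= #|` A t.-1|%:R.
Proof.
case: t => [//|[|t]] _; first by rewrite exploration1.
by rewrite explorationS//=; case: ltP => //; rewrite in_fset1U eqxx.
Qed.

(** After the first round, a round is added only while the count is below the threshold, which
    increases with [t]; the overshoot is at most one. *)
Lemma card_exploration_le t : 0 < q -> #|` A t|%:R <= v * t%:R `^ q^-1 + 1.
Proof.
move=> q0; elim: t => [|[|t] IH].
- by rewrite card_exploration0 addr_ge0// mulr_ge0 ?powR_ge0// ltW.
- by rewrite card_exploration1 lerDr mulr_ge0 ?powR_ge0// ltW.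
rewrite explorationS//; case: ifP => [h|_].
  by rewrite cardfsU1 exploration_notin add1n -natr1 lerD2r ltW.
apply: (le_trans IH); rewrite lerD2r ler_wpM2l ?(ltW v0)//.
by rewrite ge0_ler_powR ?nnegrE ?invr_ge0 ?(ltW q0)// ler_nat.
Qed.

Lemma sum_exploration n :
  \sum_(1 <= t < n.+1) (t \in A t)%:R = #|` A n|%:R :> R.
Proof.
elim: n => [|n IH]; first by rewrite big_geq// card_exploration0.
by rewrite big_nat_recr//= IH card_explorationS natrD.
Qed.

(** The quotient counts the [n] in [1..k] with [oslash n d = i.+1]. It jumps from [k] to [k.+1]
    exactly when [d] divides [k + (d - i)], that is, when [k] is [i] modulo [d]. *)
Lemma divn_round_robin k d i : (i < d)%N ->
  ((k.+1 + (d.-1 - i)) %/ d = (k + (d.-1 - i)) %/ d + (oslash k.+1 d == i.+1))%N.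
Proof.
move=> id; have d0 : (0 < d)%N by exact: leq_ltn_trans id.
rewrite addSn divnS// addnC; congr addn; rewrite /oslash /= eqSS.
have -> : (k + (d.-1 - i)).+1 = (k + (d - i))%N.
  by rewrite -addnS -subSn ?prednK// -ltnS prednK.
rewrite /dvdn -modnDml; have kd := ltn_pmod k d0; move: kd.
set c := (k %% d)%N => kd.
have [->|ci] := eqVneq c i; first by rewrite subnKC ?modnn// ltnW.
have [lt_ci|le_ic] := ltnP c i.
  rewrite modn_small; last by rewrite -[ltnRHS](subnKC (ltnW id)) ltn_add2r.
  by rewrite addn_eq0 subn_eq0 leqNgt id andbF.
have lt_ic : (i < c)%N by rewrite ltn_neqAle eq_sym ci.
rewrite addnBA ?(ltnW id)// addnC -addnBA ?(ltnW lt_ic)// modnDl modn_small.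
  by rewrite subn_eq0 leqNgt lt_ic.
exact: leq_ltn_trans (leq_subr _ _) kd.
Qed.

Lemma round_robin_count t d i : (i < d)%N ->
  (\sum_(1 <= j < t.+1) ((j \in A j) && (oslash #|` A j| d == i.+1)) =
   (#|` A t| + (d.-1 - i)) %/ d)%N.
Proof.
move=> id; have d0 : (0 < d)%N by exact: leq_ltn_trans id.
elim: t => [|t IH].
  rewrite big_geq// card_exploration0 add0n divn_small//.
  by rewrite (leq_ltn_trans (leq_subr _ _))// prednK.
rewrite big_nat_recr//= IH card_explorationS.
case: (t.+1 \in A t.+1) => /=; last by rewrite !addn0.
by rewrite addn1 divn_round_robin.
Qed.

Lemma round_robin_count_ge t d i : (i < d)%N ->
  #|` A t|%:R / d%:R - 1 <=
  (\sum_(1 <= j < t.+1) ((j \in A j) && (oslash #|` A j| d == i.+1)))%N%:R :> R.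
Proof.
move=> id; have d0 : (0 < d)%N by exact: leq_ltn_trans id.
rewrite round_robin_count//; set k := #|` A t|; set n := (_ %/ d)%N.
rewrite lerBlDr ler_pdivrMr ?ltr0n// natr1 -natrM ler_nat.
apply: (@leq_trans (k + (d.-1 - i))); first exact: leq_addr.
exact: ltnW (ltn_ceil _ d0).
Qed.

End Exploration.

(** * From a suboptimal choice to a high walk *)

Section EstimationError.
Context {dsp : measure_display} {Omega : measurableType dsp} {R : realType}.
Context {P : probability Omega R} {m : nat} {V : finType}.
Variables (src dst : 'I_m -> V) (s r : V).
Variables (mu : 'I_m -> probability R R) (v q : R).
Variables (W : nat -> 'I_m -> {RV P >-> R}) (X : nat -> Omega -> epath m).
Local Notation Q := (paths src dst s r).

Lemma simple_path_uniq (p : epath m) : p \in Q -> uniq p.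
Proof.
by rewrite inE => /and3P[_ _]; rewrite /vertices_of /= => /andP[_ /map_uniq].
Qed.

(** The mean cost is a linear functional of the path vector, because a simple path repeats no
    edge. *)
Lemma path_mean_spanner d (B : 'I_d -> epath m) (a : epath m -> 'I_d -> R) p :
  (forall i, B i \in Q) -> spanner_coefficients src dst s r B a -> p \in Q ->
  path_mean mu p = \sum_(i < d) a p i * path_mean mu (B i).
Proof.
move=> BQ ha pQ.
have meanE p' : p' \in Q ->
    path_mean mu p' = \sum_e path_vector R p' 0 e * \int[mu e]_x x.
  move=> /simple_path_uniq up; rewrite /path_mean big_uniq//= big_mkcond /=.
  by apply: eq_bigr => e _; rewrite mxE; case: ifP => _; rewrite ?mul1r ?mul0r.
rewrite meanE// (ha p pQ).2.
under [RHS]eq_bigr do rewrite meanE// mulr_sumr.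
rewrite exchange_big/=; apply: eq_bigr => e _.
by rewrite summxE mulr_suml; apply: eq_bigr => i _; rewrite mxE mulrA.
Qed.

(** Serves to replace [d] by the number of edges in thresholds, which keeps the final constant free
    of [d]. *)
Lemma barycentric_spanner_le d (B : 'I_d -> epath m) :
  barycentric_spanner src dst s r R B -> (d <= m)%N.
Proof.
move=> [dE _ _ _]; rewrite dE /path_dim.
apply: leq_trans (dimvS (subvf _)) _.
by rewrite dimvf /dim /= mul1n.
Qed.

(** The walk at [t.-1] covers exactly the rounds [j < t] that enter the sample mean at [t]. *)
Lemma walkE c eps p t w :
  let n := (\sum_(1 <= j < t | X j w == p) 1)%N in
  walk mu W X c eps p t.-1 w =
    c * (\sum_(1 <= j < t | X j w == p) path_cost W j p w - n%:R * path_mean mu p)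
    - eps * n%:R.
Proof.
case: t => [|t] /=; first by rewrite /walk !big_geq// mul0r mulr0 subrr mulr0 subr0.
have NE : (\sum_(1 <= j < t.+1 | X j w == p) 1)%N%:R =
    \sum_(1 <= j < t.+1) (X j w == p)%:R :> R.
  by rewrite natr_sum big_mkcond; apply: eq_bigr => j _; case: ifP.
have SE : \sum_(1 <= j < t.+1 | X j w == p) path_cost W j p w =
    \sum_(1 <= j < t.+1) (X j w == p)%:R * path_cost W j p w.
  by rewrite big_mkcond; apply: eq_bigr => j _; case: ifP => _; rewrite ?mul1r ?mul0r.
rewrite NE SE mulr_suml -sumrB !mulr_sumr -sumrB; apply: eq_bigr => j _.
by ring.
Qed.

(** If every basis sample mean were within [2 * eps], every path estimate would be within
    [2 * m * eps], and the minimizing path could not be worse than [sigma1] by more than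
    [4 * m * eps]. The sign [c] is the direction of the error of some bad basis path. *)
Lemma sample_mean_error d (B : 'I_d -> epath m) (a : epath m -> 'I_d -> R)
    theta0 (eps : R) sigma1 t w :
  0 < v -> 0 < eps -> sigma1 \in Q ->
  barycentric_spanner src dst s r R B -> spanner_coefficients src dst s r B a ->
  adaptive_shortest_path_routing W Q (exploration v q) B a theta0 X ->
  (0 < t)%N -> t \notin exploration v q t ->
  4 * m%:R * eps < path_mean mu (X t w) - path_mean mu sigma1 ->
  exists (i : 'I_d) (c : R), (c = 1 \/ c = -1) /\
    eps * (v * t%:R `^ q^-1 / m.+1%:R - 1) <= walk mu W X c eps (B i) t.-1 w.
Proof.
move=> v0 eps0 sQ spB ha alg t0 tA gap.
have [XQ] := alg t w t0; rewrite (negbTE tA) => Xmin.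
have dm := barycentric_spanner_le spB; have [_ BQ _ _] := spB.
pose N i := (\sum_(1 <= j < t | X j w == B i) 1)%N.
(* As [t] is not explored, enough earlier rounds were, and they are shared in turn by [d <= m] basis
   paths. Using [m.+1] also avoids a zero denominator. *)
have Nge (i : 'I_d) : v * t%:R `^ q^-1 / m.+1%:R - 1 <= (N i)%:R.
  have d0 : (0 < d)%N by exact: leq_ltn_trans (ltn_ord i).
  apply: (@le_trans _ _ (#|` exploration v q t.-1|%:R / d%:R - 1)).
    rewrite lerD2r; apply: (@le_trans _ _ (v * t%:R `^ q^-1 / d%:R)).
      rewrite ler_wpM2l ?mulr_ge0 ?powR_ge0 ?(ltW v0)//.
      by rewrite lef_pV2 ?posrE ?ltr0n// ler_nat (leq_trans dm).
    by rewrite ler_wpM2r ?invr_ge0// exploration_skip.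
  apply: (le_trans (round_robin_count_ge v q t.-1 (ltn_ord i))).
  rewrite ler_nat prednK// /N [leqRHS]big_mkcond/= big_nat [leqRHS]big_nat.
  apply: leq_sum => j /andP[j0 jt].
  case jA : (j \in exploration v q j) => //=.
  case: eqP => //= ji; have [_] := alg j w j0.
  by rewrite jA => /(_ i (esym ji)) ->; rewrite eqxx.
have [i hi] : exists i, 2 * eps <= `|sample_mean W X theta0 (B i) t w - path_mean mu (B i)|.
  apply/not_existsP => /= hn.
  have est p : p \in Q -> `|path_estimate W B a theta0 X p t w - path_mean mu p| <=
      2 * m%:R * eps.
    move=> pQ; rewrite (path_mean_spanner BQ ha pQ) /path_estimate -sumrB.
    apply: le_trans (ler_norm_sum _ _ _) _.
    apply: (@le_trans _ _ (\sum_(i < d) 2 * eps)).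
      apply: ler_sum => i _; rewrite -mulrBr normrM -[leRHS]mul1r.
      apply: ler_pM => //; first exact: (ha p pQ).1.
      by have /negP := hn i; rewrite -ltNge => /ltW.
    rewrite sumr_const card_ord -[leLHS]mulr_natr -mulrA [eps * _]mulrC mulrA.
    by rewrite ler_wpM2r ?(ltW eps0)// ler_wpM2l// ler_nat.
  have := est _ XQ; have := est _ sQ; have := Xmin _ sQ.
  rewrite !ler_norml => h /andP[h1 h2] /andP[h3 h4].
  by move: gap; lra.
exists i; move: hi; rewrite /sample_mean -/(N i).
set S := \sum_(1 <= j < t | X j w == B i) _.
set th := path_mean mu (B i).
have wE c : walk mu W X c eps (B i) t.-1 w = c * (S - (N i)%:R * th) - eps * (N i)%:R.
  exact: walkE.
have NE : eps * (v * t%:R `^ q^-1 / m.+1%:R - 1) <= eps * (N i)%:R.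
  by rewrite ler_wpM2l ?(ltW eps0).
(* Without observations the walk is [0] and the threshold is not positive, so the claim holds
   whatever the default estimate. *)
case: eqP => [N0 _|/eqP N0].
  exists 1; split; first by left.
  have S0 : S = 0.
    rewrite /S big1_seq// => j /andP[jB jt].
    move: N0; rewrite /N sum1_count => /eqP; rewrite -leqn0 leqNgt -has_count.
    by move=> /negP; case; apply/hasP; exists j.
  by rewrite wE S0; apply: (le_trans NE); rewrite N0 mul0r subr0 !mulr0 subr0.
have Npos : (0 : R) < (N i)%:R by rewrite ltr0n lt0n.
have -> : S / (N i)%:R - th = (S - (N i)%:R * th) / (N i)%:R.
  by field; rewrite gt_eqF.
rewrite normrM normfV (gtr0_norm Npos) ler_pdivlMr// => hN.
have [sg|sg] := lerP 0 (S - (N i)%:R * th); move: hN.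
  rewrite ger0_norm// => hN; exists 1; split; first by left.
  by rewrite wE; apply: (le_trans NE); lra.
rewrite ltr0_norm// => hN; exists (-1); split; first by right.
by rewrite wE; apply: (le_trans NE); lra.
Qed.

End EstimationError.

(** * Regret as a sum of expected gaps between path means *)

Section Regret.
Context {dsp : measure_display} {Omega : measurableType dsp} {R : realType}.
Context {P : probability Omega R} {m : nat}.
Variables (mu : 'I_m -> probability R R) (q : R).
Variables (W : nat -> 'I_m -> {RV P >-> R}) (X : nat -> Omega -> epath m).
Hypothesis q1 : 1 < q.
Hypothesis iidW : iid_costs W.
Hypothesis margW : marginals W mu.
Hypothesis momW : forall t e, (0 < t)%N ->
  ('E_P[fun w => (`|W t e w| `^ q)%R] < +oo)%E.
Hypothesis polX : policy W X.

Lemma choice_sum (F : epath m -> R) t w :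
  F (X t w) = \sum_p (X t w == p)%:R * F p.
Proof.
rewrite (bigD1 (X t w))//= eqxx mul1r big1 ?addr0// => p.
by rewrite eq_sym => /negbTE ->; rewrite mul0r.
Qed.

(** The cost of the chosen path is split over the finitely many paths by indicators of the choice.
    Each indicator depends on the past only, so the current cost can be replaced by its mean. *)
Lemma integral_round_regret t sigma1 : (0 < t)%N ->
  [/\ P.-integrable setT
        (fun w => (path_cost W t (X t w) w - path_cost W t sigma1 w)%:E),
      P.-integrable setT
        (fun w => (path_mean mu (X t w) - path_mean mu sigma1)%:E)
    & (\int[P]_w (path_cost W t (X t w) w - path_cost W t sigma1 w)%:E =
       \int[P]_w (path_mean mu (X t w) - path_mean mu sigma1)%:E)%E].
Proof.
case: t => [//|t] _.
pose D p := path_mean mu p - path_mean mu sigma1.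
pose V p w := path_cost W t.+1 p w - path_cost W t.+1 sigma1 w.
pose b p w : R := (X t.+1 w == p)%:R.
have iC p := path_cost_integrable q1 margW momW p (ltn0Sn t).
have mC p : measurable_fun setT (path_cost W t.+1 p).
  exact/measurable_EFinP/(measurable_int P (iC p)).
have iV p : P.-integrable setT (EFin \o V p).
  exact: (integrableB _ (iC p) (iC sigma1)).
have EV p : (\int[P]_w (V p w)%:E = (D p)%:E)%E.
  rewrite /V; under eq_integral do rewrite EFinB.
  by rewrite integralB_EFin// !(integral_path_cost q1 margW momW).
have mV p : measurable_fun setT (V p) by exact: measurable_funB.
have mb p : measurable_fun setT (b p) := choice_indic_measurable polX p (ltn0Sn t).
pose V' p : {mfun Omega >-> R} :=
  HB.pack (V p) (isMeasurableFun.Build _ _ _ _ _ (mV p)).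
pose b' p : {mfun Omega >-> R} :=
  HB.pack (b p) (isMeasurableFun.Build _ _ _ _ _ (mb p)).
have indep p : independent_maps P (b' p) (V' p).
  pose g (v : 'I_m -> R) := \sum_(e <- p) v e - \sum_(e <- sigma1) v e.
  apply: (past_independent_maps (n := t) (g := g) iidW).
    exact: (policy_past_indic p polX (ltn0Sn t)).
  by apply: measurable_funB; apply: measurable_sum => e;
    exact: measurable_coordinate.
have b01 p w : 0 <= b' p w <= 1 by rewrite /b' /= /b; case: eqP => _; rewrite ?lexx ler01.
have bV p := integral_independentM (indep p) (b01 p) (iV p).
have ib p : P.-integrable setT (fun w => (b p w)%:E).
  apply: (@measurable_bounded_integrable _ _ _ P (b p) setT) => //.
    exact: le_lt_trans (probability_le1 P measurableT) (ltry _).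
  exists 1; split => // x x1 w _ /=; have /andP[b0 b1] := b01 p w.
  by rewrite ger0_norm// (le_trans b1)// ltW.
have iD p : P.-integrable setT (fun w => (b p w)%:E * (D p)%:E)%E.
  exact: integrableZr.
have costE w : (path_cost W t.+1 (X t.+1 w) w - path_cost W t.+1 sigma1 w)%:E =
    (\sum_p (b p w * V p w)%:E)%E.
  by rewrite sumEFin -(choice_sum (fun p => V p w)).
have meanE w : (path_mean mu (X t.+1 w) - path_mean mu sigma1)%:E =
    (\sum_p (b p w)%:E * (D p)%:E)%E.
  by under eq_bigr do rewrite -EFinM; rewrite sumEFin -(choice_sum D).
split.
- have : P.-integrable setT (fun w => \sum_p (b p w * V p w)%:E)%E.
    by apply: integrable_sum => // p _; exact: (bV p).1.
  by apply: eq_integrable => // w _; rewrite costE.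
- have : P.-integrable setT (fun w => \sum_p (b p w)%:E * (D p)%:E)%E.
    by apply: integrable_sum => // p _; exact: iD.
  by apply: eq_integrable => // w _; rewrite meanE.
under eq_integral do rewrite costE.
under [RHS]eq_integral do rewrite meanE.
rewrite integral_sum//; last by move=> p; exact: (bV p).1.
rewrite integral_sum//; apply: eq_bigr => p _.
rewrite integralZr//.
have := (bV p).2; rewrite /b' /V' /= => ->.
by rewrite EV.
Qed.

Lemma regretE sigma1 T :
  (regret W X sigma1 T =
   \sum_(1 <= t < T.+1) \int[P]_w (path_mean mu (X t w) - path_mean mu sigma1)%:E)%E.
Proof.
rewrite /regret unlock.
(* Exchanging sum and integral asks for integrability at every index, while the costs are controlled
   for [t >= 1] only; hence the value [0] at time [0]. *)
pose f t w := if (0 < t)%N then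
  (path_cost W t (X t w) w - path_cost W t sigma1 w)%:E else 0%E.
transitivity (\int[P]_w \sum_(1 <= t < T.+1) f t w)%E.
  apply: eq_integral => w _; rewrite -sumEFin big_nat [RHS]big_nat.
  by apply: eq_bigr => t /andP[t0 _]; rewrite /f t0.
rewrite integral_sum//; last first.
  move=> t; rewrite /f; case t0 : (0 < t)%N; last exact: integrable0.
  by have [] := integral_round_regret sigma1 t0.
rewrite big_nat [RHS]big_nat; apply: eq_bigr => t /andP[t0 _]; rewrite /f t0.
by have [_ _ ->] := integral_round_regret sigma1 t0.
Qed.

End Regret.

(** * Choice of the constants and summation over the rounds *)

Lemma exists_positive_gap (R : realType) (I : finType) (f : I -> R) :
  exists2 g : R, 0 < g & forall i j, f j < f i -> g <= f i - f j.
Proof.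
(* The cap [1] gives a positive value even when [f] is constant. *)
exists (\big[Order.min/1]_(z : I * I | f z.2 < f z.1) (f z.1 - f z.2)).
  by apply: lt_bigmin => // z; rewrite subr_gt0.
move=> i j ji.
exact: (@bigmin_le_cond _ R _ 1 (i, j) (fun z : I * I => f z.2 < f z.1)
  (fun z => f z.1 - f z.2)).
Qed.

Theorem theorem3 (R : realType) (m : nat) (mu : 'I_m -> probability R R)
    (q v : R) (hq : 1 < q) (hv : 0 < v) :
  exists D : R,
    forall (V : finType) (src dst : 'I_m -> V) (s r : V),
    simple_path_digraph src dst s r ->
    forall (dsp : measure_display) (Omega : measurableType dsp)
      (P : probability Omega R) (W : nat -> 'I_m -> {RV P >-> R}),
    iid_costs W ->
    marginals W mu ->
    (forall t e, (0 < t)%N ->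
       ('E_P[fun w => (`|W t e w| `^ q)%R] < +oo)%E) ->
    forall sigma1 : epath m,
    min_expected_cost W (paths src dst s r) sigma1 ->
    forall (d : nat) (B : 'I_d -> epath m) (a : epath m -> 'I_d -> R),
    barycentric_spanner src dst s r R B ->
    spanner_coefficients src dst s r B a ->
    forall (theta0 : R) (X : nat -> Omega -> epath m),
    policy W X ->
    adaptive_shortest_path_routing W (paths src dst s r) (exploration v q)
      B a theta0 X ->
    forall T : nat,
    (regret W X sigma1 T <= (D * d%:R * T%:R `^ q^-1)%:E)%E.
Proof.
have q0 : 0 < q by exact: lt_trans hq.
have a0 : 0 < q - 1 by rewrite subr_gt0.
pose th (p : epath m) := path_mean mu p.
(* The gap, like [M] and [Dm] below, ranges over all edge sequences of length at most [m], since the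
   constant must be fixed before the graph. *)
have [g g0 gap] := exists_positive_gap th.
have m0 : (0 : R) < m.+1%:R by rewrite ltr0n.
pose eps := g / (4 * m.+1%:R).
have eps0 : 0 < eps by rewrite divr_gt0// mulr_gt0.
have eps_gap : 4 * m%:R * eps < g.
  have -> : g = 4 * m.+1%:R * eps by rewrite /eps; field; rewrite gt_eqF.
  by rewrite ltr_pM2r// ltr_pM2l// ltr_nat.
pose M := \sum_(p : epath m) increment_moment_bound mu q eps p.
have imb0 (p : epath m) := increment_moment_bound_ge0 mu q eps p.
have MM p : increment_moment_bound mu q eps p <= M.
  by rewrite /M (bigD1 p)//= lerDl sumr_ge0.
have M0 : 0 <= M by exact: sumr_ge0.
have [r [r1 er] [b [b01 ba] hr]] := exists_drift_barrier a0 eps0 M0.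
have r0 : 0 < r by exact: lt_le_trans r1.
pose y := eps * v / m.+1%:R.
have y0 : 0 < y by rewrite divr_gt0// mulr_gt0.
pose kappa := (r / y) `^ (q - 1).
have kappa0 : 0 <= kappa by exact: powR_ge0.
pose Dm := 2 * \sum_(p : epath m) `|th p|.
have Dm0 : 0 <= Dm by rewrite mulr_ge0// sumr_ge0.
have DmE p p' : th p - th p' <= Dm.
  have thS p1 : `|th p1| <= \sum_(p : epath m) `|th p|.
    by rewrite (bigD1 p1)//= lerDl sumr_ge0.
  have := thS p; have := thS p'; rewrite !ler_norml /Dm.
  by move=> /andP[h1 h2] /andP[h3 h4]; lra.
(* The height forced by a bad sample mean, plus [r]: reaching that height brings the walk within [r]
   of the barrier, where the crossing bound is [1]. *)
pose x (t : nat) := r + eps * (v * t%:R `^ q^-1 / m.+1%:R - 1).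
have Gx t : (0 < t)%N ->
    crossing_bound (q - 1) r (x t) <= kappa * t%:R `^ (q^-1 - 1).
  move=> t0; have tR : (0 : R) < t%:R by rewrite ltr0n.
  have tq0 : 0 < (t%:R : R) `^ q^-1 by exact: powR_gt0.
  apply: (le_trans (@crossing_bound_le _ _ _ _ (y * t%:R `^ q^-1) a0 r0 _ _)).
  - exact: mulr_gt0.
  (* Here [eps <= r] absorbs the [- eps] in [x t]. *)
  - rewrite le_max; apply/orP; left; rewrite /x mulrBr mulr1.
    have -> : y * t%:R `^ q^-1 = eps * (v * t%:R `^ q^-1 / m.+1%:R).
      by rewrite /y; field; rewrite gt_eqF.
    by rewrite addrCA lerDl subr_ge0.
  have -> : r / (y * t%:R `^ q^-1) = (r / y) * t%:R `^ (- q^-1).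
    by rewrite powRN; field; rewrite !gt_eqF.
  rewrite powRM ?powR_ge0//; last exact: divr_ge0 (ltW r0) (ltW y0).
  rewrite -powRrM.
  rewrite le_eqVlt; apply/orP; left; apply/eqP; congr (_ * _ `^ _).
  by field; rewrite gt_eqF.
(* The part [v + 1] pays for exploration; [2 * kappa * q] pays for the two error directions summed
   over time. *)
clearbody kappa Dm; exists (Dm * (v + 1 + 2 * kappa * q)).
move=> V src dst s0 r' _ dsp Omega P W iidW margW momW sigma1 [sQ smin].
move=> d B a spB ha theta0 X polX alg T.
pose Q := paths src dst s0 r'.
have sopt p : p \in Q -> th sigma1 <= th p.
  move=> pQ; have := smin p pQ.
  by rewrite unlock !(integral_path_cost hq margW momW)// lee_fin.
have XQ t w : (0 < t)%N -> X t w \in Q by move=> t0; have [] := alg t w t0.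
rewrite (regretE hq iidW margW momW polX).
have [_ BQ _ _] := spB.
(* For [d = 0] the claimed bound is [0]. The spanner is then empty, so all path means vanish and so
   does the regret. *)
have [d0|d0] := posnP d.
  have th0 p : p \in Q -> th p = 0.
    move=> pQ; rewrite /th (path_mean_spanner mu BQ ha pQ) big1// => i _.
    by have := leq_ltn_trans (leq0n i) (ltn_ord i); rewrite [X in (_ < X)%N]d0.
  rewrite big_nat big1 => [|t /andP[t0 _]]; first by rewrite d0 mulr0 mul0r.
  rewrite (eq_integral (cst 0%E)) ?integral0// => w _.
  by rewrite -/(th _) -/(th sigma1) !th0 ?subrr//; exact: XQ.
have round t : (0 < t)%N ->
    (\int[P]_w (th (X t w) - th sigma1)%:E <=
     (Dm * ((t \in exploration v q t)%:R +
            d%:R * (2 * kappa * t%:R `^ (q^-1 - 1))))%:E)%E.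
  move=> t0.
  have [_ iD _] := integral_round_regret hq iidW margW momW polX sigma1 t0.
  have mD := measurable_int P iD.
  have D0 w : (0 <= (th (X t w) - th sigma1)%:E)%E.
    by rewrite lee_fin subr_ge0 sopt// XQ.
  have k0 : 0 <= 2 * kappa * t%:R `^ (q^-1 - 1).
    by rewrite mulr_ge0 ?powR_ge0// mulr_ge0.
  case tA : (t \in exploration v q t).
    apply: (@le_trans _ _ (\int[P]_(w in setT) (cst Dm%:E) w)%E).
      apply: ge0_le_integral => //.
      by move=> w _; rewrite lee_fin DmE.
    rewrite integral_cst//= probability_setT mule1 lee_fin.
    rewrite -[leLHS]mulr1 ler_wpM2l// lerDl mulr_ge0//.
  pose F (c : R) (i : 'I_d) w : \bar R :=
    (crossing_bound (q - 1) r (x t - walk mu W X c eps (B i) t.-1 w))%:E.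
  have F0 c i w : (0 <= F c i w)%E by rewrite lee_fin crossing_bound_ge0.
  have mF c i : measurable_fun setT (F c i).
    apply/measurable_EFinP.
    apply: (measurableT_comp (measurable_crossing_bound (q - 1) r0)).
    by apply: measurable_funB => //; exact: walk_measurable.
  have FI c i : `|c| = 1 -> (\int[P]_w F c i w <=
      (kappa * t%:R `^ (q^-1 - 1))%:E)%E.
    move=> c1; apply: le_trans (_ : _ <= (crossing_bound (q - 1) r (x t))%:E)%E _.
      exact: (integral_crossing_walk_le hq iidW margW momW polX (x t) t.-1
        c1 (ltW eps0) b01 ba r1 (MM (B i)) hr).
    by rewrite lee_fin Gx.
  (* A union bound over basis paths and error directions: [S] is at least [1] whenever a suboptimal
     path is exploited. *)
  pose S w : \bar R := (\sum_(i < d) (F 1%R i w + F (-1)%R i w))%E.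
  have mS : measurable_fun setT S.
    by apply: emeasurable_sum => i; exact: emeasurable_funD.
  have FF0 i w : (0 <= F 1%R i w + F (-1)%R i w)%E by exact: adde_ge0.
  have S0 w : (0 <= S w)%E by apply: sume_ge0 => i _; exact: FF0.
  apply: (@le_trans _ _ (\int[P]_w (Dm%:E * S w))%E).
    apply: ge0_le_integral => //; first exact: measurable_funeM.
    move=> w _; have [le0|gt0] := leP (th (X t w)) (th sigma1).
      by apply: (@le_trans _ _ 0%E); [rewrite lee_fin subr_le0|exact: mule_ge0].
    apply: (@le_trans _ _ (Dm%:E * 1)%E); first by rewrite mule1 lee_fin.
    rewrite lee_wpmul2l ?lee_fin//.
    have [||i [c [c1 hc]]] := @sample_mean_error _ _ _ _ _ _ _ _ _ _ mu v q W X
      _ B a theta0 eps sigma1 t w hv eps0 sQ spB ha alg t0.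
    - by rewrite tA.
    - exact: lt_le_trans eps_gap (gap _ _ gt0).
    have Fc : F c i w = 1%E.
      by rewrite /F crossing_bound1// /x -addrA gerDl subr_le0.
    rewrite /S (bigD1 i)//=; apply: (@le_trans _ _ (F 1%R i w + F (-1)%R i w)%E).
      case: c1 Fc => -> ->; first by rewrite leeDl.
      by rewrite leeDr.
    by rewrite leeDl// sume_ge0.
  rewrite ge0_integralZl//.
  have -> k : Dm * (false%:R + k) = Dm * k by rewrite mulr0n add0r.
  rewrite EFinM; apply: lee_wpmul2l; first by rewrite lee_fin.
  rewrite ge0_integral_sum//; last by move=> i; exact: emeasurable_funD.
  apply: (@le_trans _ _ (\sum_(i < d) (2 * kappa * t%:R `^ (q^-1 - 1))%:E)%E).
    apply: lee_sum => i _; rewrite ge0_integralD//.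
    have -> : 2 * kappa * t%:R `^ (q^-1 - 1) =
        kappa * t%:R `^ (q^-1 - 1) + kappa * t%:R `^ (q^-1 - 1) by ring.
    by rewrite EFinD leeD// FI// ?normrN normr1.
  by rewrite sumEFin lee_fin sumr_const card_ord -[leLHS]mulr_natl.
apply: (@le_trans _ _ (\sum_(1 <= t < T.+1) (Dm * ((t \in exploration v q t)%:R +
    d%:R * (2 * kappa * t%:R `^ (q^-1 - 1))))%:E)%E).
  rewrite big_nat [leRHS]big_nat; apply: lee_sum => t /andP[t0 _].
  exact: round.
rewrite sumEFin lee_fin -mulr_sumr big_split/= sum_exploration.
rewrite -!mulr_sumr -!mulrA ler_wpM2l//.
set Z := \sum_(1 <= t < T.+1) _; have hZ : Z <= q * T%:R `^ q^-1 := sum_powR_le T hq.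
(* Allows the exploration cost, which carries no factor [d], to be absorbed in the bound. *)
have d1 : (1 : R) <= d%:R by rewrite ler1n.
have Tq0 : 0 <= (T%:R : R) `^ q^-1 by exact: powR_ge0.
have AT : #|` exploration v q T|%:R <= (v + 1) * T%:R `^ q^-1.
  case: (T) => [|n]; first by rewrite card_exploration0 mulr_ge0 ?powR_ge0// addr_ge0// ltW.
  apply: le_trans (card_exploration_le hv n.+1 q0) _.
  by rewrite mulrDl mul1r lerD2l powR_ge1 ?invr_ge0 ?(ltW q0)// ler1n.
apply: (@le_trans _ _ (d%:R * ((v + 1) * T%:R `^ q^-1) +
   d%:R * (2 * (kappa * (q * T%:R `^ q^-1))))).
  apply: lerD; last by rewrite !ler_wpM2l.
  apply: (le_trans AT); rewrite -[leLHS]mul1r ler_wpM2r// mulr_ge0//.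
  by rewrite addr_ge0// ltW.
by rewrite le_eqVlt; apply/orP; left; apply/eqP; ring.
Qed.
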